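(* Assume $K<\infty$. For every $(u,\gamma)\in BV(a,b)\times\mathcal M(a,b)$ with $\|u\|_{L^\infty}\le K$, $\gamma=D^su+g\mathcal L^1$, $g\in L^1(a,b)$, $u'-g\in L^2(a,b)$, one has $E''(u,\gamma)\le E(u,\gamma)$.
   Context: Fix $0<a<b<\infty$, $c_0>0$, $K\in(0,\infty)$; $f(t)=c_0\min\{t,1\}$; $I_\varepsilon(x)=(x-\varepsilon,x+\varepsilon)$; $\fint_Bh=\frac1{|B|}\int_Bh$. Flat norm $\|\mu\|_{\rm flat}=\sup\{\int\varphi\,d\mu:\varphi\in W^{1,\infty}_0(a,b),\|\varphi\|_{W^{1,\infty}}\le1\}$. For $u\in BV(a,b)$: $Du=u'\mathcal L^1+D^su$, $D^su=[u]\mathcal H^0\llcorner J_u+D^cu$. $E_\varepsilon(u,\gamma)=\int_a^b|u'-g|^2dx+\frac1\varepsilon\int_a^bf\big(\varepsilon\fint_{I_\varepsilon(x)\cap(a,b)}|g|dt\big)dx$ if $u\in W^{1,1}(a,b)$, $\|u\|_{L^\infty}\le K$, $\gamma=g\mathcal L^1$, $g\in L^1$, $u'-g\in L^2$; $+\infty$ otherwise. $E''(u,\gamma)=\inf\{\limsup_{\varepsilon\to0}E_\varepsilon(u_\varepsilon,\gamma_\varepsilon):u_\varepsilon\to u\text{ in }L^1,\ \|\gamma_\varepsilon-\gamma\|_{\rm flat}\to0\}$. $E(u,\gamma)=\int_a^b|u'-g|^2+c_0\int_a^b|g|+2\sum_{x\in J_u}f(\frac12|[u](x)|)+c_0|D^cu|(a,b)$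 if $u\in BV$, $\|u\|_\infty\le K$, $\gamma=D^su+g\mathcal L^1$, $g\in L^1$, $u'-g\in L^2$; $+\infty$ otherwise. *)

(* Defs.v *)
From HB Require Import structures.
From mathcomp Require Import all_boot all_order all_algebra.
From mathcomp Require Import all_classical all_reals all_analysis.
Set Implicit Arguments. Unset Strict Implicit. Unset Printing Implicit Defensive.
Import Order.TTheory GRing.Theory Num.Theory.
Import numFieldNormedType.Exports.
Local Open Scope classical_set_scope.
Local Open Scope ring_scope.

Section defs.
Context {R : realType}.
Notation mu := (@lebesgue_measure R).
Local Open Scope ereal_scope.

(** Finite signed (Borel) measures on R; elements of M(a,b) are those
    concentrated on (a,b). *)
Definition sm := {charge set (measurableTypeR R) -> \bar R}.

Definition hahnP (nu : sm) : set R := projT1 (cid (Hahn_decomposition nu)).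
Definition hahnN (nu : sm) : set R :=
  projT1 (cid (projT2 (cid (Hahn_decomposition nu)))).
Definition hahnH (nu : sm) : hahn_decomposition nu (hahnP nu) (hahnN nu) :=
  projT2 (cid (projT2 (cid (Hahn_decomposition nu)))).

Definition cint (nu : sm) (D : set R) (phi : R -> R) : \bar R :=
  \int[jordan_pos (hahnH nu)]_(x in D) (phi x)%:E
  - \int[jordan_neg (hahnH nu)]_(x in D) (phi x)%:E.

Variables (a b : R).
Definition I : set R := `]a, b[%classic.

Definition concentrated (nu : set R -> \bar R) :=
  forall A : set R, measurable A -> nu A = nu (A `&` I).

Definition test_fun (phi : R -> R) :=
  (forall x, derivable phi x 1) /\ continuous (derive1 phi) /\
  exists c d, (a < c)%R /\ (d < b)%R /\
    forall x, (x < c)%R \/ (d < x)%R -> phi x = 0%R.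

Definition Linf_bd (u : R -> R) (K : R) :=
  {ae mu, forall x, I x -> (`|u x| <= K)%R}.

Definition L1 (h : R -> R) := mu.-integrable I (EFin \o h).

Definition L2 (h : R -> R) :=
  measurable_fun I h /\ \int[mu]_(x in I) ((h x) ^+ 2)%:E < +oo.

Definition W11 (u u' : R -> R) :=
  L1 u /\ L1 u' /\
  forall phi, test_fun phi ->
    \int[mu]_(x in I) (u x * (derive1 phi) x)%:E
    = - \int[mu]_(x in I) (u' x * phi x)%:E.

Definition BVder (u : R -> R) (Du : sm) :=
  L1 u /\ concentrated Du /\
  forall phi, test_fun phi ->
    \int[mu]_(x in I) (u x * (derive1 phi) x)%:E = - cint Du I phi.

Definition lebdec (Du : sm) (u' : R -> R) (Ds : sm) :=
  L1 u' /\ concentrated Ds /\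
  (exists N : set R, measurable N /\ mu N = 0 /\
     forall A : set R, measurable A -> Ds A = Ds (A `&` N)) /\
  forall A : set R, measurable A ->
    Du A = \int[mu]_(x in A `&` I) (u' x)%:E + Ds A.

(** jump set J_u: atoms of Du in (a,b); [u](x) = Du({x}) *)
Definition jumpset (Du : sm) : set R := [set x | I x /\ Du [set x] != 0].

Definition cantor_part (Du Ds : sm) (A : set R) : \bar R :=
  Ds (A `\` jumpset Du).

Definition tv (nu : set R -> \bar R) (D : set R) : \bar R :=
  ereal_sup [set s | exists (n : nat) (A : nat -> set R),
    (forall i, measurable (A i) /\ A i `<=` D) /\
    (forall i j, i != j -> A i `&` A j = set0) /\
    s = \sum_(i < n) `|nu (A i)|].

Variables (K c0 : R).

Definition fc (t : R) : R := (c0 * Num.min t 1)%R.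

Definition Ieps (eps x : R) : set R := `](x - eps)%R, (x + eps)%R[%classic.

Definition avg (eps : R) (g : R -> R) (x : R) : R :=
  (fine (\int[mu]_(t in Ieps eps x `&` I) (`|g t|)%:E)
   / fine (mu (Ieps eps x `&` I)))%R.

(** E_eps(u, gamma) (+oo when no admissible representation exists) *)
Definition Eeps (eps : R) (u : R -> R) (gamma : sm) : \bar R :=
  ereal_inf [set v | exists u' g : R -> R,
    W11 u u' /\ Linf_bd u K /\ L1 g /\
    (forall A : set R, measurable A ->
       gamma A = \int[mu]_(x in A `&` I) (g x)%:E) /\
    L2 (fun x => u' x - g x)%R /\
    v = \int[mu]_(x in I) ((u' x - g x) ^+ 2)%:E
        + (eps^-1)%:E * \int[mu]_(x in I) (fc (eps * avg eps g x))%:E].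

(** test functions for the flat norm: phi in W^{1,oo}_0(a,b),
    ||phi||_{W^{1,oo}} = max(||phi||_oo, ||phi'||_oo) <= 1 *)
Definition flat_test (phi : R -> R) :=
  phi a = 0%R /\ phi b = 0%R /\
  (forall x, (a <= x <= b)%R -> (`|phi x| <= 1)%R) /\
  (forall x y, (a <= x <= b)%R -> (a <= y <= b)%R ->
     (`|phi x - phi y| <= `|x - y|)%R).

Definition flatdist (g1 g2 : sm) : \bar R :=
  ereal_sup [set cint g1 I phi - cint g2 I phi | phi in flat_test].

Definition Eupper (u : R -> R) (gamma : sm) : \bar R :=
  ereal_inf [set l | exists (ue : R -> R -> R) (ge : R -> sm),
    (fun e => \int[mu]_(x in I) (`|ue e x - u x|)%:E) @ 0%R^'+ --> 0 /\
    (fun e => flatdist (ge e) gamma) @ 0%R^'+ --> 0 /\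
    l = limf_esup (fun e => Eeps e (ue e) (ge e)) 0%R^'+].

Definition Elim (u : R -> R) (gamma : sm) : \bar R :=
  ereal_inf [set v | exists (Du : sm) (u' : R -> R) (Ds : sm) (g : R -> R),
    BVder u Du /\ lebdec Du u' Ds /\ Linf_bd u K /\ L1 g /\
    (forall A : set R, measurable A ->
       gamma A = Ds A + \int[mu]_(x in A `&` I) (g x)%:E) /\
    L2 (fun x => u' x - g x)%R /\
    v = \int[mu]_(x in I) ((u' x - g x) ^+ 2)%:E
        + c0%:E * \int[mu]_(x in I) (`|g x|)%:E
        + 2%:E * (\esum_(x in jumpset Du) (fc (`|fine (Du [set x])| / 2))%:E)
        + c0%:E * tv (cantor_part Du Ds) I].

End defs.

(* Main.v *)
(** The recovery sequence is obtained by one-sided mollification at scale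
    [d = e ^+ 2].  By the lemma of du Bois-Reymond, [u] agrees a.e. with
    [c + Du(]-oo, x])], which stays bounded by [K] when extended by its trace
    [c] to the left of [a].  Averaging this function over the window
    [`]x - d, x]] gives [ue], with derivative [Du(`]x - d, x]) / d], and
    [ge] has the density [gamma(`]x - d, x]) / d] on [`]a, b[]; the difference
    of the two densities is the window average of [u' - g], so its L2 norm does
    not exceed that of [u' - g] (Jensen), and both convergences hold at rate [d]
    by Fubini.  For the nonlocal term, let [B] be the finite set of jumps of
    size at least 2.  Where the averaging interval meets the mollified image of
    a point of [B], the integrand is bounded by [c0], at a cost [2 * c0] per
    point of [B] in the limit; elsewhere [fc t <= c0 * t], and by Tonelli the
    average costs at most [c0] times the variation of [gamma] off [B], up to the
    masses of two boundary layers, which vanish with [e].  That variation is at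
    most [\int |g| + |D^c u| + \sum_(jumps of size < 2) |[u]|], and [2 * fc (t / 2)]
    equals [2 * c0] for [2 <= t] and [c0 * t] for [0 <= t <= 2]. *)
Require Import Defs.
From HB Require Import structures.
From mathcomp Require Import finmap all_boot all_order all_algebra.
From mathcomp Require Import all_classical all_reals all_analysis.
From mathcomp Require Import measurable_realfun lra.
Import Order.TTheory GRing.Theory Num.Theory.
Import numFieldNormedType.Exports.
Local Open Scope classical_set_scope.
Local Open Scope ring_scope.
Set Implicit Arguments. Unset Strict Implicit. Unset Printing Implicit Defensive.

Section integral_sections.
Context d1 d2 (T1 : measurableType d1) (T2 : measurableType d2) (R : realType).
Variables (S : set (T1 * T2)) (mS : measurable S).
Local Open Scope ereal_scope.

Let restrict_fst_xsection (m : {measure set T2 -> \bar R}) (F : T1 -> \bar R) x :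
  \int[m]_y ((F \o fst) \_ S) (x, y) = F x * m (xsection S x).
Proof.
rewrite -integral_cst; last exact: measurable_xsection.
by rewrite [RHS]integral_mkcond; apply: eq_integral => y _; rewrite !patchE mem_xsection.
Qed.

Let restrict_fst_ysection (m : {measure set T1 -> \bar R}) (F : T1 -> \bar R) y :
  \int[m]_x ((F \o fst) \_ S) (x, y) = \int[m]_(x in ysection S y) F x.
Proof.
by rewrite [RHS]integral_mkcond; apply: eq_integral => x _; rewrite !patchE mem_ysection.
Qed.

Let measurable_restrict_fst (F : T1 -> \bar R) :
  measurable_fun setT F -> measurable_fun setT ((F \o fst) \_ S).
Proof.
move=> mF; have mFfst : measurable_fun setT (F \o @fst T1 T2).
  by apply: (measurableT_comp mF); exact: measurable_fst.
by apply: (measurable_restrictT _ mS).1; exact: measurable_funTS.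
Qed.

Lemma ge0_integral_xsection (m1 : {sigma_finite_measure set T1 -> \bar R})
    (m2 : {sigma_finite_measure set T2 -> \bar R}) (F : T1 -> \bar R) :
  measurable_fun setT F -> (forall x, 0 <= F x) ->
  \int[m1]_x (F x * m2 (xsection S x)) = \int[m2]_y \int[m1]_(x in ysection S y) F x.
Proof.
move=> mF F0; under eq_integral do rewrite -restrict_fst_xsection.
under [RHS]eq_integral do rewrite -restrict_fst_ysection.
apply: (fubini_tonelli ((F \o fst) \_ S)); first exact: measurable_restrict_fst.
by apply: erestrict_ge0 => z _; exact: F0.
Qed.

Lemma integral_xsection (m1 : {sigma_finite_measure set T1 -> \bar R})
    (m2 : {finite_measure set T2 -> \bar R}) (F : T1 -> \bar R) :
  m1.-integrable setT F ->
  \int[m1]_x (F x * m2 (xsection S x)) = \int[m2]_y \int[m1]_(x in ysection S y) F x.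
Proof.
move=> iF; have mF := measurable_int _ iF.
have maF : measurable_fun setT (abse \o F) by exact: measurableT_comp.
under eq_integral do rewrite -restrict_fst_xsection.
under [RHS]eq_integral do rewrite -restrict_fst_ysection.
apply: (@Fubini _ _ _ _ _ m1 m2 ((F \o fst) \_ S)).
apply/integrable12ltyP; first exact: measurable_restrict_fst.
rewrite (_ : integral m1 _ _ = \int[m1]_x (`|F x| * m2 (xsection S x))); last first.
  apply: eq_integral => x _; rewrite -(restrict_fst_xsection m2 (abse \o F)).
  by apply: eq_integral => y _; rewrite !patchE; case: ifPn => //; rewrite abse0.
apply: (@le_lt_trans _ _ (\int[m1]_x (`|F x| * m2 setT))).
  apply: ge0_le_integral => //.
  - by move=> x _; exact: mule_ge0.
  - by apply: emeasurable_funM => //; exact: measurable_fun_xsection.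
  - exact: emeasurable_funM.
  - move=> x _; rewrite lee_wpmul2l// le_measure ?inE//.
    exact: measurable_xsection.
rewrite ge0_integralZr// lte_mul_pinfty//; first exact: integral_ge0.
- by apply: integrable_fin_num => //; exact: integrable_abse.
- by rewrite ltey_eq fin_num_measure.
Qed.

End integral_sections.

Section difference_relation.
Context {R : realType}.
Implicit Types (J : set R) (x y : R).
Local Notation RT := (measurableTypeR R).
Local Open Scope ereal_scope.

Definition difference_in J : set (RT * RT) := [set z | J (z.1 - z.2)%R].

Lemma measurable_difference_in J : measurable J -> measurable (difference_in J).
Proof.
move=> mJ; have mB : measurable_fun setT (fun z : RT * RT => (z.1 - z.2)%R : R).
  by apply: measurable_funB; [exact: measurable_fst|exact: measurable_snd].
by have := mB measurableT J mJ; rewrite setTI.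
Qed.

Lemma xsection_difference_in J x : xsection (difference_in J) x = [set y | J (x - y)%R].
Proof. by apply/seteqP; split => y; rewrite /xsection/= inE. Qed.

Lemma ysection_difference_in J y : ysection (difference_in J) y = [set x | J (x - y)%R].
Proof. by apply/seteqP; split => x; rewrite /ysection/= inE. Qed.

Lemma measurable_mass_difference (m : {sigma_finite_measure set RT -> \bar R}) J :
  measurable J -> measurable_fun [set: R] (fun x => m [set y | J (x - y)%R]).
Proof.
move=> mJ; have := measurable_fun_xsection m (measurable_difference_in mJ).
by apply: eq_measurable_fun => x _ /=; rewrite xsection_difference_in.
Qed.

Lemma ge0_integral_difference (m1 m2 : {sigma_finite_measure set RT -> \bar R}) J
    (F : R -> \bar R) :
  measurable J -> measurable_fun [set: R] F -> (forall x, 0 <= F x) ->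
  \int[m1]_x (F x * m2 [set y | J (x - y)%R]) =
  \int[m2]_y \int[m1]_(x in [set x | J (x - y)%R]) F x.
Proof.
move=> mJ mF F0; under eq_integral do rewrite -xsection_difference_in.
under [RHS]eq_integral do rewrite -ysection_difference_in.
exact: (ge0_integral_xsection (measurable_difference_in mJ) m1 m2 mF).
Qed.

Lemma integral_difference (m1 : {sigma_finite_measure set RT -> \bar R})
    (m2 : {finite_measure set RT -> \bar R}) J (F : R -> \bar R) :
  measurable J -> m1.-integrable [set: R] F ->
  \int[m1]_x (F x * m2 [set y | J (x - y)%R]) =
  \int[m2]_y \int[m1]_(x in [set x | J (x - y)%R]) F x.
Proof.
move=> mJ iF; under eq_integral do rewrite -xsection_difference_in.
under [RHS]eq_integral do rewrite -ysection_difference_in.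
exact: (integral_xsection (measurable_difference_in mJ) m2 iF).
Qed.

End difference_relation.

Section measure_complements.
Context d (T : measurableType d) (R : realType).
Local Open Scope ereal_scope.

Lemma integrable_bounded (m : {measure set T -> \bar R}) (D : set T) (f : T -> R) (M : R) :
  measurable D -> m D < +oo -> measurable_fun D f ->
  (forall x, D x -> (`|f x| <= M)%R) -> m.-integrable D (EFin \o f).
Proof.
move=> mD mDoo mf fM; apply: measurable_bounded_integrable => //.
by exists M; split=> [|k Mk x Dx /=]; [exact: num_real|exact: le_trans (fM x Dx) (ltW Mk)].
Qed.

Lemma finite_integrable_bounded (m : {finite_measure set T -> \bar R}) (D : set T) (f : T -> R)
    (M : R) : measurable D -> measurable_fun D f -> (forall x, D x -> (`|f x| <= M)%R) ->
  m.-integrable D (EFin \o f).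
Proof.
by move=> mD; apply: integrable_bounded => //; rewrite ltey_eq fin_num_measure.
Qed.

Lemma integrableB_EFin (m : {measure set T -> \bar R}) (D : set T) (f g : T -> R) :
  measurable D -> m.-integrable D (EFin \o f) -> m.-integrable D (EFin \o g) ->
  m.-integrable D (EFin \o (fun x => f x - g x)%R).
Proof. by move=> mD; exact: (@integrableB _ _ _ m D mD (EFin \o f) (EFin \o g)). Qed.

Lemma integrableZl_EFin (m : {measure set T -> \bar R}) (D : set T) (k : R) (f : T -> R) :
  measurable D -> m.-integrable D (EFin \o f) ->
  m.-integrable D (EFin \o (fun x => k * f x)%R).
Proof. by move=> mD; exact: (@integrableZl _ _ _ m D mD k (EFin \o f)). Qed.

(* No measurability is needed: the integral of a nonnegative function is a
   supremum over the simple functions below it. *)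
Lemma ge0_le_integralT (m : {measure set T -> \bar R}) (D : set T) (f1 f2 : T -> \bar R) :
  (forall x, D x -> 0 <= f1 x) -> (forall x, 0 <= f2 x) -> (forall x, D x -> f1 x <= f2 x) ->
  \int[m]_(x in D) f1 x <= \int[m]_x f2 x.
Proof.
move=> f10 f20 f12; rewrite integral_mkcond !ge0_integralTE//; last exact: erestrict_ge0.
apply: le_ereal_sup => _ [h hf <-]; exists h => // x; apply: le_trans (hf x) _.
by rewrite patchE; case: ifPn => //; rewrite inE; exact: f12.
Qed.

Lemma integral_support (m : {measure set T -> \bar R}) (D : set T) (f : T -> \bar R) :
  (forall x, ~ D x -> f x = 0) -> \int[m]_(x in D) f x = \int[m]_x f x.
Proof.
move=> f0; rewrite integral_mkcond; apply: eq_integral => x _; rewrite patchE.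
by case: ifPn => // /negP; rewrite inE => /f0 ->.
Qed.

Lemma integral_patch_EFin (m : {measure set T -> \bar R}) (D E : set T) (f : T -> R) :
  \int[m]_(x in D) ((f \_ E) x)%:E = \int[m]_(x in D `&` E) (f x)%:E.
Proof. by rewrite integral_mkcondr restrict_EFin. Qed.

Lemma integral_sub_le (m : {measure set T -> \bar R}) (f : T -> R) (A B D : set T) :
  m.-integrable D (EFin \o f) -> measurable D -> measurable A -> measurable B ->
  A `<=` D -> B `<=` D -> A `&` B = set0 ->
  \int[m]_(x in A) (f x)%:E - \int[m]_(x in B) (f x)%:E <= \int[m]_(x in D) (`|f x|)%:E.
Proof.
move=> intf mD mA mB AD BD AB0; have mf := measurable_int _ intf.
have mabs : measurable_fun D (fun x => (`|f x|)%:E).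
  by apply/measurable_EFinP/measurableT_comp => //; exact/measurable_EFinP.
have abs_le (E : set T) : measurable E -> E `<=` D ->
    `|\int[m]_(x in E) (f x)%:E| <= \int[m]_(x in E) (`|f x|)%:E.
  by move=> mE ED; apply: le_abse_integral => //; exact: measurable_funS mf.
apply: (@le_trans _ _ (\int[m]_(x in A `|` B) (`|f x|)%:E)).
  rewrite ge0_integral_setU//; last by rewrite disj_set2E AB0.
    apply: leeD; first exact: le_trans (lee_abs _) (abs_le _ mA AD).
    by apply: le_trans (abs_le _ mB BD); rewrite -abseN lee_abs.
  by apply: measurable_funS mabs; rewrite ?subUset.
by apply: ge0_subset_integral => //; [exact: measurableU|rewrite subUset].
Qed.

Lemma integral_indicT (m : {measure set T -> \bar R}) (A : set T) :
  measurable A -> \int[m]_x (\1_A x)%:E = m A.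
Proof. by move=> mA; rewrite integral_indic// setIT. Qed.

Lemma aeS (m : {measure set T -> \bar R}) (P Q : T -> Prop) : (forall x, P x -> Q x) ->
  {ae m, forall x, P x} -> {ae m, forall x, Q x}.
Proof. by apply: filterS; exact: (ae_filter_ringOfSetsType m). Qed.

Lemma ae_exists (m : {measure set T -> \bar R}) (P : T -> Prop) (A : set T) :
  {ae m, forall x, P x} -> measurable A -> 0 < m A -> exists2 x, A x & P x.
Proof.
move=> [N [mN N0 PN]] mA; apply: contraPP => noP; apply/negP; rewrite -leNgt -N0.
apply: le_measure; rewrite ?inE// => x Ax; apply: PN => /= Px.
by apply: noP; exists x.
Qed.

Lemma ge0_esumZl (I : choiceType) (D : set I) (f : I -> \bar R) (k : R) : (0 <= k)%R ->
  (forall i, 0 <= f i) -> \esum_(i in D) (k%:E * f i) = k%:E * (\esum_(i in D) f i).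
Proof.
move=> k0 f0; rewrite /esum -ereal_supZl//; last first.
  by apply/set0P; exists (\sum_(i \in set0) f i), set0 => //; exact: fsets_set0.
rewrite image_comp; congr ereal_sup; apply: eq_imagel => F [finF FD] /=.
by rewrite ge0_mule_fsumr.
Qed.

Lemma finite_set_measurable (A : set T) : (forall x : T, measurable [set x]) ->
  finite_set A -> measurable A.
Proof. by move=> m1 finA; apply: countable_measurable => //; exact: finite_set_countable. Qed.

Lemma measure_countable_esum (m : {measure set T -> \bar R}) (A : set T) :
  (forall x : T, measurable [set x]) -> countable A -> m A = \esum_(x in A) m [set x].
Proof.
move=> m1 /countable_bijP[B]; rewrite card_eq_sym => /pcard_eqP[/= f].
have fBA : set_bij B A f by exact: 'bij_f.
rewrite (reindex_esum _ _ _ _ fBA).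
rewrite -[X in m X](image_eq fBA) -bigcup_imset1 measure_bigcup//; last first.
  move=> i j Bi Bj [x [-> /= fij]]; apply: (set_bij_inj fBA) => //; exact/mem_set.
by rewrite nneseries_esum// set_mem_set.
Qed.

Lemma finite_heavy_atoms (m : {finite_measure set T -> \bar R}) (r : R) :
  (forall x : T, measurable [set x]) -> (0 < r)%R ->
  finite_set [set x | r%:E <= m [set x]].
Proof.
move=> m1 r0; apply: contrapT => infinite_heavy.
pose k := (Num.truncn (fine (m setT) / r)).+1.
have [X heavyX kX] := infinite_set_fset k infinite_heavy.
have finX : finite_set [set` X] by exact: finite_fset.
have mX : measurable ([set` X] : set T) by exact: finite_set_measurable.
have : (k%:R * r)%:E <= m [set` X].
  rewrite measure_countable_esum//; last exact: finite_set_countable.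
  rewrite esum_fset// fsbig_finite//= set_fsetK.
  apply: (@le_trans _ _ (\sum_(x <- X) r%:E)).
    rewrite sumEFin lee_fin big_const_seq count_predT iter_addr_0 -[leRHS]mulr_natl.
    by rewrite ler_pM2r// ler_nat.
  by rewrite !big_seq; apply: lee_sum => x; exact: heavyX.
move=> /le_trans/(_ (le_measure m (mem_set mX) (mem_set measurableT) (@subsetT _ _))).
by rewrite -(fineK (fin_num_measure m _ measurableT)) lee_fin leNgt -ltr_pdivrMr// truncnS_gt.
Qed.

Lemma countable_atoms (m : {finite_measure set T -> \bar R}) :
  (forall x : T, measurable [set x]) -> countable [set x | m [set x] != 0].
Proof.
move=> m1; apply: (@sub_countable _ _ _ (\bigcup_n [set x | n.+1%:R^-1%:E <= m [set x]])).
  apply: subset_card_le => x /= mx.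
  have mxfin : m [set x] \is a fin_num by exact: fin_num_measure.
  have [|n mxn] := @ltr_add_invr R 0%R (fine (m [set x])).
    by rewrite fine_gt0// measure_gt0 mx ltey_eq mxfin.
  by exists n => //=; rewrite -(fineK mxfin) lee_fin ltW// -[ltLHS]add0r.
apply: bigcup_countable => // n _; apply: finite_set_countable.
exact: finite_heavy_atoms.
Qed.

Lemma cvg_measure_at_right0 (m : {finite_measure set T -> \bar R}) (A : R -> set T) (a : R) :
  (forall r, measurable (A r)) -> (forall r s, (r <= s)%R -> A r `<=` A s) ->
  \bigcap_n A (a + n.+1%:R^-1)%R = set0 -> m (A r) @[r --> a^'+] --> 0.
Proof.
move=> mA leA A0; apply/fine_cvgP; split; first by apply: nearW => r; exact: fin_num_measure.
have : m (A (a + n.+1%:R^-1)%R) @[n --> \oo] --> 0.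
  rewrite -(measure0 m) -A0; apply: nonincreasing_cvg_mu => //.
  - by rewrite ltey_eq fin_num_measure.
  - by rewrite A0.
  - move=> n k nk; apply/subsetPset/leA.
    by rewrite lerD2l lef_pV2 ?posrE// ler_nat.
move=> /fine_cvgP[_ /cvgrPdist_lt An]; apply/cvgrPdist_lt => e /An[n _ /(_ n (leqnn n)) Ane].
near=> r; apply: le_lt_trans Ane.
rewrite /= !sub0r !normrN !ger0_norm ?fine_ge0// fine_le ?fin_num_measure//.
apply: le_measure; rewrite ?inE//; apply: leA; near: r.
by apply: nbhs_right_le; rewrite ltrDl.
Unshelve. all: by end_near. Qed.

End measure_complements.

Section density.
Context d (T : measurableType d) (R : realType).
Variables (mu : {sigma_finite_measure set T -> \bar R}) (f : T -> R).
Hypotheses (f_ge0 : forall x, (0 <= f x)%R) (intf : mu.-integrable setT (EFin \o f)).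
Local Open Scope ereal_scope.

Let induced_ge0 (A : set T) : 0 <= induced_charge intf A.
Proof. by apply: integral_ge0 => x _; rewrite /= lee_fin. Qed.

Definition density : set T -> \bar R := measure_of_charge (induced_charge intf) induced_ge0.

HB.instance Definition _ := Measure.on density.

Let density_fin : fin_num_fun density.
Proof. by move=> A mA; exact: (fin_num_measure (induced_charge intf)). Qed.

HB.instance Definition _ := Measure_isFinite.Build _ _ _ density density_fin.

Lemma densityE (A : set T) : density A = \int[mu]_(x in A) (f x)%:E.
Proof. by []. Qed.

Let measurable_f (D : set T) : measurable_fun D (EFin \o f).
Proof. by apply: measurable_funTS; exact: measurable_int intf. Qed.

Lemma density_dominates : density `<< mu.
Proof.
by apply/null_content_dominatesP => A mA A0; rewrite densityE; apply: null_set_integral.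
Qed.

Lemma ge0_integral_density (D : set T) (phi : T -> \bar R) :
  measurable D -> measurable_fun D phi -> (forall x, 0 <= phi x) ->
  \int[density]_(x in D) phi x = \int[mu]_(x in D) (phi x * (f x)%:E).
Proof.
move=> mD mphi phi0; set g := Radon_Nikodym_SigmaFinite.f density mu.
rewrite -(Radon_Nikodym_SigmaFinite.change_of_variables density_dominates)//.
have ig : mu.-integrable setT g by exact: Radon_Nikodym_SigmaFinite.f_integrable density_dominates.
apply: ae_eq_integral => //.
- by apply: emeasurable_funM => //; apply: measurable_funTS; exact: measurable_int ig.
- exact: emeasurable_funM.
apply: ae_eqe_mul2l; apply: integral_ae_eq => //.
- exact: (integrableS measurableT).
- by move=> A AD mA; rewrite -(Radon_Nikodym_SigmaFinite.f_integral density_dominates).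
Qed.

Lemma integral_density (D : set T) (phi : T -> \bar R) :
  measurable D -> measurable_fun D phi ->
  \int[density]_(x in D) phi x = \int[mu]_(x in D) (phi x * (f x)%:E).
Proof.
move=> mD mphi; rewrite integralE [RHS]integralE.
rewrite !ge0_integral_density//; [|exact: measurable_funeneg|exact: measurable_funepos].
congr (_ - _); apply: eq_integral => x _; rewrite ?funeposE ?funenegE.
  by rewrite maxe_pMl ?lee_fin// mul0e.
by rewrite maxe_pMl ?lee_fin// mul0e mulNe.
Qed.

End density.

Section signed_measures.
Context {R : realType}.
Local Notation RT := (measurableTypeR R).
Implicit Types (nu : @sm R) (A D : set RT).
Local Open Scope ereal_scope.

Lemma cint_decomp nu (m1 m2 : {finite_measure set RT -> \bar R}) D (phi : R -> R) (M : R) :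
  (forall A, measurable A -> A `<=` D -> nu A = m1 A - m2 A) ->
  measurable D -> measurable_fun D phi -> (forall x, D x -> (`|phi x| <= M)%R) ->
  cint nu D phi = \int[m1]_(x in D) (phi x)%:E - \int[m2]_(x in D) (phi x)%:E.
Proof.
move=> nuE mD mphi phiM; rewrite /cint.
set p : {finite_measure set RT -> \bar R} := jordan_pos (hahnH nu).
set n : {finite_measure set RT -> \bar R} := jordan_neg (hahnH nu).
have iphi (m : {finite_measure set RT -> \bar R}) : m.-integrable D (EFin \o phi).
  exact: finite_integrable_bounded phiM.
have fin_int m := integrable_fin_num mD (iphi m).
have pm2_nm1 A : measurable A -> A `<=` D -> measure_add p m2 A = measure_add n m1 A.
  move=> mA AD; rewrite !measure_addE.
  have := jordan_decomp (hahnH nu) mA; rewrite nuE// /cadd/= /cscale/= -/p -/n.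
  rewrite -(fineK (fin_num_measure p _ mA)) -(fineK (fin_num_measure n _ mA)).
  rewrite -(fineK (fin_num_measure m1 _ mA)) -(fineK (fin_num_measure m2 _ mA)).
  by rewrite -!EFinM -!EFinB -!EFinD => -[e]; congr EFin; lra.
have := @eq_measure_integral _ RT R D _ _ (EFin \o phi) pm2_nm1.
rewrite !integral_measure_add//; [|exact: iphi..].
rewrite -(fineK (fin_int p)) -(fineK (fin_int n)) -(fineK (fin_int m1)) -(fineK (fin_int m2)).
by rewrite -!EFinB -!EFinD => -[e]; congr EFin; lra.
Qed.

Definition jordanP nu : {finite_measure set RT -> \bar R} := jordan_pos (hahnH nu).
Definition jordanN nu : {finite_measure set RT -> \bar R} := jordan_neg (hahnH nu).

Lemma jordanB nu A : measurable A -> nu A = jordanP nu A - jordanN nu A.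
Proof. by move=> mA; rewrite (jordan_decomp (hahnH nu) mA) /cadd/= cscaleN1. Qed.

Lemma jordanPE nu A : measurable A -> jordanP nu A = nu (A `&` hahnP nu).
Proof.
move=> mA; rewrite -[LHS]/(jordan_pos (hahnH nu) A) jordan_posE/= /crestr0/=.
by rewrite mem_set.
Qed.

Lemma jordanNE nu A : measurable A -> jordanN nu A = - nu (A `&` hahnN nu).
Proof.
move=> mA; rewrite -[LHS]/(jordan_neg (hahnH nu) A) jordan_negE/= /cscale/= mulN1e.
by rewrite /crestr0/= mem_set.
Qed.

Lemma measurable_hahnP nu : measurable (hahnP nu).
Proof. by have [[]] := hahnH nu. Qed.

Lemma measurable_hahnN nu : measurable (hahnN nu).
Proof. by have [_ []] := hahnH nu. Qed.

Definition variation nu : set RT -> \bar R := charge_variation (hahnH nu).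
HB.instance Definition _ nu := Measure.on (variation nu).
HB.instance Definition _ nu := Measure_isFinite.Build _ _ _ (variation nu)
  (fun A mA => fin_num_measure (charge_variation (hahnH nu)) A mA).

Lemma variationE nu A : variation nu A = jordanP nu A + jordanN nu A.
Proof. by []. Qed.

Lemma abse_le_variation nu A : measurable A -> `|nu A| <= variation nu A.
Proof. exact: abse_charge_variation. Qed.

Lemma variation_hahn nu A : measurable A ->
  variation nu A = nu (A `&` hahnP nu) - nu (A `&` hahnN nu).
Proof. by move=> mA; rewrite variationE jordanPE// jordanNE. Qed.

Lemma variation_set1 nu (x : R) : variation nu [set x] = `|nu [set x]|.
Proof.
have [[_ posP] [_ negN] PN PN0] := hahnH nu.
rewrite variation_hahn; last exact: measurable_set1.
have [Px|nPx] := pselect (hahnP nu x).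
  have nNx : ~ hahnN nu x by move=> Nx; have : set0 x by rewrite -PN0.
  rewrite (setIidl (_ : [set x] `<=` _)); last by move=> _ ->.
  rewrite (_ : _ `&` hahnN nu = set0); last by apply/seteqP; split=> // _ [-> /nNx].
  by rewrite charge0 sube0 gee0_abs//; apply: posP => // _ ->.
have Nx : hahnN nu x by have : setT x by []; rewrite -PN => -[].
rewrite (_ : _ `&` hahnP nu = set0); last by apply/seteqP; split=> // _ [-> /nPx].
rewrite (setIidl (_ : [set x] `<=` _)); last by move=> _ ->.
by rewrite charge0 sub0e lee0_abs//; apply: negN => // _ ->.
Qed.

Lemma measurable_I (a b : R) : measurable (I a b : set RT).
Proof. exact: measurable_itv. Qed.

Lemma variation_concentrated (a b : R) nu : concentrated a b nu -> variation nu (~` I a b) = 0.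
Proof.
move=> nuI; have mI := measurable_I a b; have mIC := measurableC mI.
have nu0 B : measurable B -> nu (~` I a b `&` B) = 0.
  move=> mB; rewrite nuI; last exact: measurableI.
  by rewrite setIAC setICl set0I charge0.
by rewrite variation_hahn// !nu0 ?sube0//; [exact: measurable_hahnN|exact: measurable_hahnP].
Qed.

End signed_measures.

Lemma limf_esup_le_cvg (R : realType) (T : topologicalType) (F : set_system T)
    (f g : T -> \bar R) (l : R) :
  Filter F -> (\forall x \near F, (f x <= g x)%E) -> g @ F --> l%:E ->
  (limf_esup f F <= l%:E)%E.
Proof.
move=> FF fg gl; apply/lee_addgt0Pr => e e0.
have near_gl : \forall x \near F, (g x <= l%:E + e%:E)%E.
  move/fine_cvgP: gl => [gfin /cvgrPdist_le/(_ _ e0) gl].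
  near=> x; have xfin : g x \is a fin_num by near: x.
  rewrite -(fineK xfin) -EFinD lee_fin.
  have : `|l - fine (g x)| <= e by near: x.
  by rewrite ler_norml; lra.
apply: (@le_trans _ _ (ereal_sup (f @` [set x | (f x <= l%:E + e%:E)%E]))).
  apply: ereal_inf_lbound; exists [set x | (f x <= l%:E + e%:E)%E] => //.
  by near=> x; apply: (@le_trans _ _ (g x)); near: x.
by apply: ge_ereal_sup => _ [x fx <-].
Unshelve. all: by end_near. Qed.

Section test_functions.
Context {R : realType}.
Local Notation RT := (measurableTypeR R).
Local Notation leb := (@lebesgue_measure R).
Implicit Types (f phi : R -> R) (m : {finite_measure set RT -> \bar R}).
Implicit Types (a b c d x y : R).

Definition vanishes_outside c d f := forall x, x < c \/ d < x -> f x = 0.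

Lemma derive1_vanishes_outside c d phi :
  vanishes_outside c d phi -> vanishes_outside c d (derive1 phi).
Proof.
move=> phi0 x xcd; rewrite derive1E (near_eq_derive (g := cst 0))//.
  by rewrite -derive1E derive1_cst.
by case: xcd => [xc|dx]; near=> y; apply: phi0; [left|right]; near: y;
  [exact: lt_nbhsl|exact: lt_nbhsr].
Unshelve. all: by end_near. Qed.

Lemma derivable_continuous phi : (forall x, derivable phi x 1) -> continuous phi.
Proof. by move=> dphi x; have /derivable1_diffP/differentiable_continuous := dphi x. Qed.

Lemma vanishes_outside_itv c d f x : vanishes_outside c d f -> x \notin `[c, d] -> f x = 0.
Proof.
by move=> f0; rewrite in_itv/= negb_and -!ltNge => /orP[xc|dx]; apply: f0; [left|right].
Qed.

Lemma vanishes_outside_bounded c d f : continuous f -> vanishes_outside c d f ->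
  exists M, forall x, `|f x| <= M.
Proof.
move=> cf f0; have [cd|dc] := leP c d; last first.
  exists 0 => x; rewrite (vanishes_outside_itv f0) ?normr0// in_itv/=.
  by apply: contraTN dc => /andP[cx /(le_trans cx)]; rewrite -leNgt.
have [|y ycd ymax] := @EVT_max R (fun x => `|f x|) c d cd.
  by apply: continuous_subspaceT => x; apply: continuous_comp; [exact: cf|exact: norm_continuous].
exists `|f y| => x; have [xcd|xcd] := boolP (x \in `[c, d]); first exact: ymax.
by rewrite (vanishes_outside_itv f0 xcd) normr0.
Qed.

Lemma vanishes_outside_integrable c d f : continuous f -> vanishes_outside c d f ->
  leb.-integrable setT (EFin \o f).
Proof.
move=> cf f0; have : leb.-integrable `[c, d] (EFin \o f).
  by apply: continuous_compact_integrable; [exact: segment_compact|exact: continuous_subspaceT].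
rewrite integrable_mkcond//; apply: eq_integrable => // x _.
rewrite patchE mem_setE; case: ifPn => //= xcd.
by rewrite (vanishes_outside_itv f0 xcd).
Qed.

Lemma integral_derive1_ray phi c d y : (forall x, derivable phi x 1) ->
  continuous (derive1 phi) -> vanishes_outside c d phi ->
  (\int[leb]_(x in `[y, +oo[) (derive1 phi x)%:E = - (phi y)%:E)%E.
Proof.
move=> dphi cphi' phi0; pose z := Num.max d y + 1.
have cphi := derivable_continuous dphi.
have yz : y < z by rewrite ltr_pwDr// le_max lexx orbT.
have dz : d < z by rewrite ltr_pwDr// le_max lexx.
transitivity (\int[leb]_(x in `[y, z]) (derive1 phi x)%:E)%E.
  rewrite integral_mkcond [RHS]integral_mkcond; apply: eq_integral => x _.
  rewrite !patchE !mem_setE !in_itv/= andbT; case: (leP y x) => //= _.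
  case: (leP x z) => // zx; rewrite (derive1_vanishes_outside phi0)//.
  by right; exact: lt_trans zx.
transitivity ((phi z)%:E - (phi y)%:E)%E; last by rewrite (phi0 z) ?sub0e//; right.
apply: continuous_FTC2; [exact: yz|exact: continuous_subspaceT| |by []].
split; [by move=> x _; exact: dphi|exact: cvg_at_right_filter (cphi y)|].
exact: cvg_at_left_filter (cphi z).
Qed.

Lemma integral_derive1_eq0 phi c d : (forall x, derivable phi x 1) ->
  continuous (derive1 phi) -> vanishes_outside c d phi ->
  (\int[leb]_x (derive1 phi x)%:E = 0)%E.
Proof.
move=> dphi cphi' phi0.
transitivity (- (phi (c - 1))%:E)%E; last by rewrite phi0 ?oppe0//; left; rewrite gtrBl.
rewrite -(integral_derive1_ray _ dphi cphi' phi0) [RHS]integral_mkcond.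
apply: eq_integral => x _; rewrite patchE mem_setE in_itv/= andbT.
case: leP => // xc; rewrite (derive1_vanishes_outside phi0)//.
by left; lra.
Qed.

Definition cumul (m : set R -> \bar R) x : R := fine (m `]-oo, x]%classic).

Lemma EFin_cumul m x : (cumul m x)%:E = m `]-oo, x]%classic.
Proof. by rewrite fineK ?fin_num_measure. Qed.

Lemma cumul_ge0 m x : 0 <= cumul m x.
Proof. by rewrite fine_ge0. Qed.

Lemma cumul_le_total m x : cumul m x <= fine (m setT).
Proof.
by apply: fine_le; rewrite ?fin_num_measure//; apply: le_measure; rewrite ?inE.
Qed.

Lemma normr_cumul_le m x : `|cumul m x| <= fine (m setT).
Proof. by rewrite ger0_norm ?cumul_ge0 ?cumul_le_total. Qed.

Lemma cumul_difference m x : m `]-oo, x]%classic = m [set y | `[0, +oo[%classic (x - y)].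
Proof. by congr (m _); apply/seteqP; split => y /=; rewrite !in_itv/= andbT subr_ge0. Qed.

Lemma difference_ray y : [set x | `[0, +oo[%classic (x - y)] = `[y, +oo[%classic.
Proof. by apply/seteqP; split => x /=; rewrite !in_itv/= !andbT subr_ge0. Qed.

Lemma measurable_cumul m D : measurable_fun D (cumul m).
Proof.
apply: measurable_funTS; apply: (measurableT_comp (@fine_measurable R setT measurableT)).
have /= := measurable_mass_difference m (measurable_itv `[0, +oo[).
by apply: eq_measurable_fun => x _; rewrite -cumul_difference.
Qed.

Lemma integral_cumul_derive1 m phi c d : (forall x, derivable phi x 1) ->
  continuous (derive1 phi) -> vanishes_outside c d phi ->
  (\int[leb]_x (cumul m x * derive1 phi x)%:E = - \int[m]_x (phi x)%:E)%E.
Proof.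
move=> dphi cphi' phi0; have cphi := derivable_continuous dphi.
have iphi' := vanishes_outside_integrable cphi' (derive1_vanishes_outside phi0).
have [M phiM] := vanishes_outside_bounded cphi phi0.
transitivity (\int[leb]_x ((derive1 phi x)%:E * m [set y | `[0%R, +oo[%classic (x - y)%R]))%E.
  by apply: eq_integral => x _; rewrite -cumul_difference -EFin_cumul -EFinM mulrC.
rewrite (integral_difference m (measurable_itv _) iphi') -integralN; last first.
  apply: integrable_add_def => //; apply: (@finite_integrable_bounded _ RT _ m setT phi M) => //.
  exact: continuous_measurable_fun.
by apply: eq_integral => y _; rewrite difference_ray (integral_derive1_ray y dphi cphi' phi0).
Qed.

Lemma test_fun_out a b phi x : test_fun a b phi -> ~ I a b x -> phi x = 0 /\ derive1 phi x = 0.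
Proof.
move=> [_ [_ [c [d [ac [db phi0]]]]]] nIx; have xcd : x < c \/ d < x.
  move: nIx; rewrite /I/= in_itv/=; case: (ltP a x) => [_ /=|xa _]; last by left; lra.
  by case: (ltP x b) => // bx _; right; lra.
by split; [exact: phi0|exact: derive1_vanishes_outside phi0 _ _].
Qed.

Lemma test_fun_bounded a b phi : test_fun a b phi ->
  exists M, [/\ forall x, `|phi x| <= M, forall x, `|derive1 phi x| <= M,
    measurable_fun setT phi & measurable_fun setT (derive1 phi)].
Proof.
move=> [dphi [cphi' [c [d [_ [_ phi0]]]]]]; have cphi := derivable_continuous dphi.
have [M1 phiM1] := vanishes_outside_bounded cphi phi0.
have [M2 phi'M2] := vanishes_outside_bounded cphi' (derive1_vanishes_outside phi0).
exists (Num.max M1 M2); split; rewrite ?le_max; [..|exact: continuous_measurable_fun].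
- by move=> x; rewrite le_max phiM1.
- by move=> x; rewrite le_max phi'M2 orbT.
- exact: continuous_measurable_fun.
Qed.

Lemma integral_cumul_test_fun m a b phi : test_fun a b phi ->
  (\int[leb]_(x in I a b) (cumul m x * derive1 phi x)%:E = - \int[m]_(x in I a b) (phi x)%:E)%E.
Proof.
move=> tphi; have [dphi [cphi' [c [d [_ [_ phi0]]]]]] := tphi.
rewrite (integral_support m) => [|x /(test_fun_out tphi)[-> _]//].
rewrite -(integral_cumul_derive1 m dphi cphi' phi0).
by apply: integral_support => x /(test_fun_out tphi)[_ ->]; rewrite mulr0.
Qed.

End test_functions.

Section du_Bois_Reymond.
Context {R : realType}.
Local Notation leb := (@lebesgue_measure R).
Implicit Types (a b c d h s x : R) (F psi : R -> R).

Lemma primitive_vanishes_outside c d psi : continuous psi ->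
  vanishes_outside c d psi -> \int[leb]_x psi x = 0 ->
  exists phi, [/\ forall x, derivable phi x 1, derive1 phi = psi & vanishes_outside c d phi].
Proof.
move=> cpsi psi0 int0; have ipsi := vanishes_outside_integrable cpsi psi0.
pose phi x := \int[leb]_(t in `]-oo, x]) psi t.
have dphi x : derivable phi x 1 /\ derive1 phi x = psi x.
  apply: (@continuous_FTC1 R psi -oo%O x (x + 1)); [by rewrite ltrDl| |exact: ltNyr|exact: cpsi].
  exact: (integrableS measurableT).
exists phi; split; [by move=> x; have [] := dphi x|by apply/funext => x; have [] := dphi x|].
move=> x [xc|dx]; rewrite /phi.
  rewrite (@eq_Rintegral _ _ _ _ _ (cst 0)) ?Rintegral_cst ?mul0r// => t.
  by rewrite inE/= in_itv/= => tx; apply: psi0; left; exact: le_lt_trans xc.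
rewrite -int0 Rintegral_mkcond; apply: eq_Rintegral => t _.
rewrite patchE mem_setE in_itv/=; case: leP => // xt.
by rewrite psi0//; right; exact: lt_trans xt.
Qed.

Definition tent s h x : R := Num.max 0 (1 - `|x - s| / h).

Lemma continuous_tent s h : continuous (tent s h).
Proof.
move=> x; apply: (@continuous_max R R (cst 0) (fun x => 1 - `|x - s| / h) x); first exact: cvg_cst.
apply: cvgB; first exact: cvg_cst.
apply: cvgM; last exact: cvg_cst.
apply: (@continuous_comp _ _ _ (fun x => x - s) Num.norm); last exact: norm_continuous.
by apply: cvgB; [exact: cvg_id|exact: cvg_cst].
Qed.

Lemma tent_ge0 s h x : 0 <= tent s h x.
Proof. by rewrite /tent le_max lexx. Qed.

Lemma tent_le1 s h x : 0 < h -> tent s h x <= 1.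
Proof. by move=> h0; rewrite /tent ge_max ler01/= gerBl divr_ge0// ltW. Qed.

Lemma tent_out_ball s h x : 0 < h -> ~ ball s h x -> tent s h x = 0.
Proof.
move=> h0 /negP; rewrite -leNgt distrC => hx; apply/max_idPl.
by rewrite subr_le0 ler_pdivlMr// mul1r.
Qed.

Lemma ball_itv_out s h x : x < s - h \/ s + h < x -> ~ ball s h x.
Proof. by rewrite ball_itv/= in_itv/=; move=> xsh; lra. Qed.

Lemma tent_mass_ge s h : 0 < h -> h / 2 <= \int[leb]_x tent s h x.
Proof.
move=> h0; pose J := `[s - h / 2, s + h / 2]%classic : set R.
have itent : leb.-integrable setT (EFin \o tent s h).
  apply: (@vanishes_outside_integrable _ (s - h) (s + h)); first exact: continuous_tent.
  by move=> x /ball_itv_out; exact: tent_out_ball.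
have -> : h / 2 = \int[leb]_x (2^-1 * \1_J x).
  rewrite RintegralZl//; last exact: integrable_indic_itv.
  have leJ : leb J = h%:E.
    by rewrite /J lebesgue_measure_itv/= lte_fin ifT -?EFinB; [congr EFin|]; lra.
  have int_J : (\int[leb]_x (\1_J x)%:E = h%:E)%E.
    by rewrite -leJ; exact: (integral_indicT leb (measurable_itv _)).
  by rewrite /Rintegral int_J/= mulrC.
apply: le_Rintegral => //.
  by apply: integrableZl_EFin => //; exact: integrable_indic_itv.
move=> x _; rewrite indicE; case: (boolP (x \in J)); last by rewrite mulr0 tent_ge0.
rewrite /J inE/= in_itv/= => xJ; rewrite mulr1 /tent le_max; apply/orP; right.
rewrite lerBrDr -lerBrDl ler_pdivrMr// ler_norml; lra.
Qed.

Definition tent_kernel s h x : R := tent s h x / \int[leb]_y tent s h y.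

Section tent_kernel.
Variables (s h : R) (h0 : 0 < h).

Let mass_gt0 : 0 < \int[leb]_y tent s h y.
Proof. by apply: lt_le_trans (tent_mass_ge s h0); rewrite divr_gt0. Qed.

Lemma continuous_tent_kernel : continuous (tent_kernel s h).
Proof. by move=> x; apply: cvgM; [exact: continuous_tent|exact: cvg_cst]. Qed.

Lemma tent_kernel_out_ball x : ~ ball s h x -> tent_kernel s h x = 0.
Proof. by move=> xsh; rewrite /tent_kernel tent_out_ball// mul0r. Qed.

Lemma tent_kernel_vanishes_outside : vanishes_outside (s - h) (s + h) (tent_kernel s h).
Proof. by move=> x /ball_itv_out; exact: tent_kernel_out_ball. Qed.

Lemma integrable_tent_kernel : leb.-integrable setT (EFin \o tent_kernel s h).
Proof.
exact: vanishes_outside_integrable continuous_tent_kernel tent_kernel_vanishes_outside.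
Qed.

Lemma integral_tent_kernel : \int[leb]_x tent_kernel s h x = 1.
Proof.
rewrite RintegralZr ?divff ?gt_eqF//.
apply: (@vanishes_outside_integrable _ (s - h) (s + h)); first exact: continuous_tent.
by move=> x /ball_itv_out; exact: tent_out_ball.
Qed.

Lemma tent_kernel_ge0 x : 0 <= tent_kernel s h x.
Proof. by rewrite divr_ge0 ?tent_ge0// ltW. Qed.

Lemma tent_kernel_le x : tent_kernel s h x <= 2 / h.
Proof.
rewrite -[leRHS]invf_div -[leRHS]mul1r; apply: ler_pM; rewrite ?tent_ge0 ?tent_le1//.
  by rewrite invr_ge0 ltW.
by rewrite lef_pV2 ?posrE ?divr_gt0// tent_mass_ge.
Qed.

Section average.
Variables (F : R -> R) (iF : leb.-integrable setT (EFin \o F)).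

Lemma integrable_mul_tent_kernel :
  leb.-integrable setT (EFin \o (fun x => F x * tent_kernel s h x)).
Proof.
apply: (integrableMl measurableT iF).
  by apply: continuous_measurable_fun; exact: continuous_tent_kernel.
exists (2 / h); split=> [|k hk x _ /=]; first exact: num_real.
by rewrite ger0_norm ?tent_kernel_ge0// (le_trans (tent_kernel_le x))// ltW.
Qed.

Let scaled_tent_kernel r : leb.-integrable setT (EFin \o (fun x => r * tent_kernel s h x)).
Proof. by apply: integrableZl_EFin => //; exact: integrable_tent_kernel. Qed.

Let centered_integrand :
  leb.-integrable setT (EFin \o (fun x => (F x - F s) * tent_kernel s h x)).
Proof.
have := integrableB_EFin measurableT integrable_mul_tent_kernel (scaled_tent_kernel (F s)).
by apply: eq_integrable => // x _; rewrite /= mulrBl.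
Qed.

Lemma tent_kernel_center : \int[leb]_x (F x * tent_kernel s h x) - F s =
  \int[leb]_(x in ball s h) ((F x - F s) * tent_kernel s h x).
Proof.
rewrite -[X in _ - X]mulr1 -integral_tent_kernel -RintegralZl//; last exact: integrable_tent_kernel.
rewrite -RintegralB//; last exact: integrable_mul_tent_kernel.
rewrite [RHS]Rintegral_mkcond; apply: eq_Rintegral => x _.
rewrite -mulrBl patchE; case: ifPn => // /negP; rewrite inE => xsh.
by rewrite tent_kernel_out_ball// mulr0.
Qed.

Lemma tent_kernel_davg :
  (`|\int[leb]_x (F x * tent_kernel s h x) - F s|%:E <= 4%:E * davg F s h)%E.
Proof.
have mB : measurable (ball s h : set (measurableTypeR R)) by exact: measurable_ball.
have iFsk := integrableS measurableT mB (@subsetT _ _) centered_integrand.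
have mFsk := measurable_int _ iFsk.
have mFs : measurable_fun (ball s h) (EFin \o (fun x => F x - F s)).
  apply/measurable_EFinP; apply: measurable_funB => //; apply: measurable_funTS.
  by apply/measurable_EFinP; exact: measurable_int iF.
have kE : (4%:E * (leb (ball s h))^-1 = (2 / h)%:E)%E.
  rewrite lebesgue_measure_ball ?ltW// inver mulrn_eq0/= gt_eqF//.
  by rewrite -EFinM; congr EFin; rewrite -(mulr_natl h) invfM; lra.
rewrite tent_kernel_center EFin_normr_Rintegral// /davg /iavg muleA kE -ge0_integralZl//.
- apply: le_trans (le_abse_integral leb mB mFsk) _; apply: ge0_le_integral => //.
  + exact: measurableT_comp.
  + by apply: emeasurable_funM => //; exact: measurableT_comp.
  + move=> x _; rewrite /= lee_fin normrM mulrC ler_wpM2r// ger0_norm ?tent_kernel_ge0//.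
    exact: tent_kernel_le.
- exact: measurableT_comp.
- by rewrite lee_fin divr_ge0// ltW.
Qed.

End average.
End tent_kernel.

Lemma cvg_tent_kernel F s : leb.-integrable setT (EFin \o F) -> lebesgue_pt F s ->
  \int[leb]_x (F x * tent_kernel s h x) @[h --> 0^'+] --> F s.
Proof.
move=> iF Fs; apply/cvgrPdist_le => e e0.
have /fine_cvgP[davg_fin /cvgrPdist_le davg_small] := Fs.
near=> h; have h0 : 0 < h by near: h; exact: nbhs_right_gt.
have dfin : davg F s h \is a fin_num by near: h.
have : `|0 - fine (davg F s h)| <= e / 4 by near: h; apply: davg_small; rewrite divr_gt0.
rewrite sub0r normrN ger0_norm ?fine_ge0 ?davg_ge0// => small.
have := tent_kernel_davg s h0 iF.
by rewrite -(fineK dfin) -EFinM lee_fin distrC; lra.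
Unshelve. all: by end_near. Qed.

Section weakly_constant.
Variables (a b : R) (f : R -> R).
Hypotheses (ab : a < b) (fL1 : L1 a b f).
Hypothesis f_orthogonal : forall phi, test_fun a b phi ->
  (\int[leb]_(x in I a b) (f x * derive1 phi x)%:E = 0)%E.

Local Notation F := (f \_ (I a b)).

Let integrable_F : leb.-integrable setT (EFin \o F).
Proof. by move: fL1; rewrite /L1 integrable_mkcond ?restrict_EFin//; exact: measurable_I. Qed.

Lemma mean0_orthogonal psi c d : a < c -> d < b -> continuous psi ->
  vanishes_outside c d psi -> \int[leb]_x psi x = 0 -> \int[leb]_x (F x * psi x) = 0.
Proof.
move=> ac db cpsi psi0 int0.
have [phi [dphi phi' phi0]] := primitive_vanishes_outside cpsi psi0 int0.
have tphi : test_fun a b phi.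
  by split; [exact: dphi|split; [rewrite phi'; exact: cpsi|exists c, d]].
transitivity (fine (0 : \bar R)) => //.
rewrite -(f_orthogonal tphi) phi' integral_mkcond; congr fine.
by apply: eq_integral => x _; rewrite !patchE; case: ifPn; rewrite ?mul0r.
Qed.

Lemma eq_lebesgue_pt s s0 : I a b s -> I a b s0 ->
  lebesgue_pt F s -> lebesgue_pt F s0 -> F s = F s0.
Proof.
rewrite /I/= !in_itv/= => /andP[a_s sb] /andP[as0 s0b] Fs Fs0.
pose lo := Num.min s s0; pose hi := Num.max s s0.
have alo : 0 < lo - a by rewrite subr_gt0 lt_min a_s.
have hib : 0 < b - hi by rewrite subr_gt0 gt_max sb.
apply/eqP; rewrite -subr_eq0; apply/eqP; apply: (cvg_unique (@norm_hausdorff _ _)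
  (cvgB (cvg_tent_kernel integrable_F Fs) (cvg_tent_kernel integrable_F Fs0))).
apply: cvg_near_cst; near=> h; have h0 : 0 < h by near: h; exact: nbhs_right_gt.
have iFk r := integrable_mul_tent_kernel r h0 integrable_F.
rewrite fctE -RintegralB//.
transitivity (\int[leb]_x (F x * (tent_kernel s h x - tent_kernel s0 h x))).
  by apply: eq_Rintegral => x _; rewrite mulrBr.
apply: (@mean0_orthogonal _ (lo - h) (hi + h)).
- by rewrite ltrBrDr -ltrBrDl; near: h; exact: nbhs_right_lt.
- by rewrite -ltrBrDl; near: h; exact: nbhs_right_lt.
- by move=> x; apply: cvgB; exact: continuous_tent_kernel.
- move=> x xh; have out r : lo <= r <= hi -> tent_kernel r h x = 0.
    move=> /andP[lor rhi]; apply: (tent_kernel_vanishes_outside h0).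
    by case: xh => xh; [left|right]; lra.
  by rewrite !out ?subrr// /lo /hi ge_min le_max lexx ?orbT//= le_max lexx.
- rewrite RintegralB ?integral_tent_kernel ?subrr//; exact: integrable_tent_kernel.
Unshelve. all: by end_near. Qed.

Lemma du_Bois_Reymond : exists c, {ae leb, forall x, I a b x -> f x = c}.
Proof.
have F_lebesgue : {ae leb, forall x, lebesgue_pt F x}.
  exact: lebesgue_differentiation (integrable_locally_restrict (measurable_I a b) fL1).
have leI : (0 < leb (I a b))%E.
  by rewrite lebesgue_measure_itv/= lte_fin ab -EFinB lte_fin subr_gt0.
have [s0 Is0 Fs0] := ae_exists F_lebesgue (measurable_I a b) leI.
exists (F s0); apply: aeS F_lebesgue => s Fs Is.
by rewrite -(eq_lebesgue_pt Is Is0 Fs Fs0) patchE mem_set.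
Qed.

End weakly_constant.

End du_Bois_Reymond.

Section left_windows.
Context {R : realType}.
Local Notation RT := (measurableTypeR R).
Local Notation leb := (@lebesgue_measure R).
Implicit Types (d x y z : R) (v f : R -> R).

Lemma lebesgue_measure_bounded_itv (b1 b2 : bool) y z : y <= z ->
  leb [set` Interval (BSide b1 y) (BSide b2 z)] = (z - y)%:E.
Proof.
move=> yz; rewrite lebesgue_measure_itv/= lte_fin -EFinB; case: ltP => // zy.
by congr EFin; lra.
Qed.

Lemma window_difference d x : `]x - d, x]%classic = [set y | `[0, d[%classic (x - y)].
Proof. by apply/seteqP; split => y /=; rewrite !in_itv/=; lra. Qed.

Lemma difference_window d y : [set x | `[0, d[%classic (x - y)] = `[y, y + d[%classic.
Proof. by apply/seteqP; split => x /=; rewrite !in_itv/=; lra. Qed.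

(* The junk value for [d <= 0] is [0]. *)
Definition lavg d v x : R := d^-1 * \int[leb]_(t in `]x - d, x]) v t.

Section window.
Variables (d x : R) (d0 : 0 < d).
Local Notation W := (`]x - d, x]%classic : set RT).

Lemma lebesgue_measure_window : leb W = d%:E.
Proof. by rewrite lebesgue_measure_bounded_itv ?gerBl 1?ltW//; congr EFin; lra. Qed.

Let mW : measurable W. Proof. exact: measurable_itv. Qed.

Let dV_ge0 : 0 <= d^-1. Proof. by rewrite invr_ge0 ltW. Qed.

Lemma window_integrable_bounded f M : measurable_fun W f -> (forall t, W t -> `|f t| <= M) ->
  leb.-integrable W (EFin \o f).
Proof.
by move=> mf; apply: integrable_bounded => //; rewrite [ltLHS]lebesgue_measure_window ltry.
Qed.

Let integrable_cst k : leb.-integrable W (EFin \o cst k).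
Proof. exact: (@window_integrable_bounded _ `|k|). Qed.

Lemma lavg_cst k : lavg d (cst k) x = k.
Proof.
rewrite /lavg Rintegral_cst// [fine _](congr1 fine lebesgue_measure_window)/=.
by rewrite mulrCA mulVf ?mulr1// gt_eqF.
Qed.

Lemma lavgD f v : leb.-integrable W (EFin \o f) -> leb.-integrable W (EFin \o v) ->
  lavg d (fun t => f t + v t) x = lavg d f x + lavg d v x.
Proof. by move=> fi vi; rewrite /lavg RintegralD// mulrDr. Qed.

Lemma lavgB f v : leb.-integrable W (EFin \o f) -> leb.-integrable W (EFin \o v) ->
  lavg d (fun t => f t - v t) x = lavg d f x - lavg d v x.
Proof. by move=> fi vi; rewrite /lavg RintegralB// mulrBr. Qed.

Lemma lavgZl k v : leb.-integrable W (EFin \o v) ->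
  lavg d (fun t => k * v t) x = k * lavg d v x.
Proof. by move=> vi; rewrite /lavg RintegralZl// mulrCA. Qed.

Lemma lavg_dist_le v (k r : R) : leb.-integrable W (EFin \o v) ->
  {ae leb, forall t, W t -> `|v t - k| <= r} -> `|lavg d v x - k| <= r.
Proof.
move=> vi vr; rewrite -[X in _ - X](lavg_cst k) -lavgB// /lavg.
have ivk : leb.-integrable W (EFin \o (fun t => v t - k)).
  exact: (integrableB_EFin mW vi (integrable_cst k)).
rewrite normrM (ger0_norm dV_ge0) ler_pdivrMl//.
rewrite -lee_fin EFin_normr_Rintegral//.
apply: le_trans (le_abse_integral leb mW (measurable_int _ ivk)) _.
have -> : (d * r)%:E = (\int[leb]_(t in W) cst r%:E t)%E.
  by rewrite integral_cst// EFinM muleC; congr (_ * _)%E; exact/esym/lebesgue_measure_window.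
have r0 : 0 <= r.
  have W0 : (0 < leb W)%E by rewrite [ltRHS]lebesgue_measure_window lte_fin.
  have [t Wt /(_ Wt)] := ae_exists vr mW W0; exact: le_trans.
apply: ae_ge0_le_integral => //.
by apply: measurableT_comp => //; exact: measurable_int ivk.
Qed.

(* Cauchy-Schwarz on the window, from [0 <= (v - q) ^+ 2] with [q] the average. *)
Lemma sqr_lavg_le v : leb.-integrable W (EFin \o v) ->
  (((lavg d v x) ^+ 2)%:E <= d^-1%:E * \int[leb]_(t in W) ((v t) ^+ 2)%:E)%E.
Proof.
move=> vi; set q := lavg d v x.
have mv2 : measurable_fun W (fun t => ((v t) ^+ 2)%:E).
  by apply/measurable_EFinP/measurable_funX/measurable_EFinP; exact: measurable_int vi.
have [->|v2fin] := eqVneq (\int[leb]_(t in W) ((v t) ^+ 2)%:E)%E +oo%E.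
  by rewrite gt0_muley ?leey// lte_fin invr_gt0.
have iv2 : leb.-integrable W (EFin \o (fun t => (v t) ^+ 2)).
  apply/integrableP; split => //; rewrite -ltey in v2fin; apply: le_lt_trans v2fin.
  rewrite le_eqVlt; apply/predU1P; left; apply: eq_integral => t _ /=.
  by rewrite ger0_norm ?sqr_ge0.
have iqv : leb.-integrable W (EFin \o (fun t => 2 * q * v t)) by exact: integrableZl_EFin.
have : lavg d (fun t => 2 * q * v t - q ^+ 2) x <= lavg d (fun t => (v t) ^+ 2) x.
  rewrite /lavg; apply: (ler_wpM2l dV_ge0); apply: (le_Rintegral mW) => //.
    exact: (integrableB_EFin mW iqv (integrable_cst (q ^+ 2))).
  by move=> t _; have := sqr_ge0 (v t - q); rewrite !expr2; nra.
rewrite (lavgB iqv (integrable_cst (q ^+ 2))) lavg_cst lavgZl// -/q => qv2.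
rewrite -[X in (_ * X)%E]fineK ?(integrable_fin_num mW iv2)// -EFinM lee_fin.
by apply: le_trans qv2; rewrite expr2; lra.
Qed.

End window.

Lemma ge0_integral_window d (F : R -> \bar R) : 0 < d -> measurable_fun setT F ->
  (forall x, (0 <= F x)%E) ->
  (\int[leb]_x \int[leb]_(t in `](x - d)%R, x]) F t = d%:E * \int[leb]_t F t)%E.
Proof.
move=> d0 mF F0; rewrite -ge0_integralZl//; last by rewrite lee_fin ltW.
have := ge0_integral_difference leb leb (measurable_itv `](- d), 0]) mF F0.
move=> /esym E; etransitivity; [|etransitivity; [exact: E|]].
- apply: eq_integral => x _; congr (integral leb _ _).
  by apply/seteqP; split => t /=; rewrite !in_itv/=; lra.
- apply: eq_integral => x _; rewrite muleC; congr (_ * _)%E.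
  have <- : leb `[x, x + d[ = d%:E.
    by rewrite lebesgue_measure_bounded_itv ?lerDl 1?ltW//; congr EFin; lra.
  by congr (leb _); apply/seteqP; split => t /=; rewrite !in_itv/=; lra.
Qed.

Lemma integral_sqr_lavg_le d v : 0 < d -> leb.-integrable setT (EFin \o v) ->
  (\int[leb]_x ((lavg d v x) ^+ 2)%:E <= \int[leb]_x ((v x) ^+ 2)%:E)%E.
Proof.
move=> d0 vi; have mv2 D : measurable_fun D (fun t => ((v t) ^+ 2)%:E).
  apply: measurable_funTS; apply/measurable_EFinP/measurable_funX/measurable_EFinP.
  exact: measurable_int vi.
have dV0 : (0 <= d^-1%:E :> \bar R)%E by rewrite lee_fin invr_ge0 ltW.
have v20 t : (0 <= ((v t) ^+ 2)%:E :> \bar R)%E by rewrite lee_fin sqr_ge0.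
rewrite [leRHS](_ : _ = \int[leb]_x \int[leb]_(t in `](x - d)%R, x]) (d^-1%:E * ((v t) ^+ 2)%:E))%E.
  apply: ge0_le_integralT => [x _|x|x _]; first by rewrite lee_fin sqr_ge0.
    by apply: integral_ge0 => t _; exact: mule_ge0.
  rewrite ge0_integralZl//; last exact: mv2.
  by apply: (sqr_lavg_le d0); exact: (integrableS measurableT).
rewrite ge0_integral_window//; last 2 first.
- exact: measurable_funeM.
- by move=> x; rewrite mule_ge0.
rewrite ge0_integralZl//; last exact: mv2.
by rewrite muleA -EFinM divff ?mul1e// gt_eqF.
Qed.

End left_windows.

Section mollification.
Context {R : realType}.
Local Notation RT := (measurableTypeR R).
Local Notation leb := (@lebesgue_measure R).
Implicit Types (m : {finite_measure set RT -> \bar R}) (nu : @sm R) (d x y : R).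
Local Open Scope ereal_scope.

Definition mollify (nu : set R -> \bar R) d x : R := (fine (nu `](x - d)%R, x]%classic) / d)%R.

Lemma window_set0 d x : (d <= 0)%R -> `](x - d)%R, x]%classic = set0.
Proof. by move=> d0; rewrite set_itv_ge// bnd_simp -leNgt; lra. Qed.

Lemma mollify_ge0 m d x : (0 <= mollify m d x)%R.
Proof.
rewrite /mollify; have [d0|d0] := leP 0%R d; first by rewrite divr_ge0 ?fine_ge0.
by rewrite window_set0 ?measure0 ?mul0r// ltW.
Qed.

Lemma EFin_mollify m d x : (mollify m d x)%:E = d^-1%:E * m `](x - d)%R, x]%classic.
Proof. by rewrite /mollify EFinM fineK ?fin_num_measure// muleC. Qed.

Lemma measurable_window_mass m d : measurable_fun setT (fun x => m `](x - d)%R, x]%classic).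
Proof.
have /= := measurable_mass_difference m (measurable_itv `[0%R, d[).
by apply: eq_measurable_fun => x _; rewrite -window_difference.
Qed.

Lemma measurable_mollify m d D : measurable_fun D (mollify m d).
Proof.
apply: measurable_funTS; apply: measurable_funM => //.
apply: (measurableT_comp (@fine_measurable R setT measurableT)).
exact: measurable_window_mass.
Qed.

Lemma ge0_integral_mollify m d (F : R -> \bar R) : (0 < d)%R ->
  measurable_fun setT F -> (forall x, 0 <= F x) ->
  \int[leb]_x (F x * (mollify m d x)%:E) =
  \int[m]_y \int[leb]_(x in `[y, (y + d)%R[) (d^-1%:E * F x).
Proof.
move=> d0 mF F0; under [RHS]eq_integral do rewrite -difference_window.
rewrite -(ge0_integral_difference leb m (measurable_itv _)); last 2 first.
- exact: measurable_funeM.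
- by move=> x; rewrite mule_ge0// lee_fin invr_ge0 ltW.
by apply: eq_integral => x _; rewrite EFin_mollify window_difference muleCA muleA.
Qed.

Lemma lebesgue_measure_right_window d y : (0 < d)%R -> leb `[y, (y + d)%R[ = d%:E.
Proof. by move=> d0; rewrite lebesgue_measure_bounded_itv ?lerDl 1?ltW//; congr EFin; lra. Qed.

Lemma integral_mollify m d : (0 < d)%R -> \int[leb]_x (mollify m d x)%:E = m setT.
Proof.
move=> d0; under eq_integral do rewrite -[_%:E]mul1e.
rewrite (@ge0_integral_mollify _ _ (cst 1))//.
rewrite -[RHS]mul1e -integral_cst//; apply: eq_integral => y _.
rewrite (eq_integral (cst d^-1%:E)); last by move=> x _; rewrite mule1.
rewrite integral_cst// [X in _ * X]lebesgue_measure_right_window//.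
by rewrite -EFinM mulVf// gt_eqF.
Qed.

Lemma integral_window_mass m d : (0 < d)%R ->
  \int[leb]_x m `](x - d)%R, x]%classic = d%:E * m setT.
Proof.
move=> d0; rewrite -(integral_mollify m d0) -ge0_integralZl//.
- apply: eq_integral => x _; rewrite EFin_mollify muleA -EFinM divff ?mul1e//.
  by rewrite gt_eqF.
- by apply/measurable_EFinP; exact: measurable_mollify.
- by move=> x _; rewrite lee_fin mollify_ge0.
- by rewrite lee_fin ltW.
Qed.

Lemma integrable_mollify m d : leb.-integrable setT (EFin \o mollify m d).
Proof.
apply/integrableP; split; first by apply/measurable_EFinP; exact: measurable_mollify.
under eq_integral do rewrite /= ger0_norm ?mollify_ge0//.
have [d0|d0] := ltP 0%R d; first by rewrite integral_mollify// ltey_eq fin_num_measure.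
rewrite (eq_integral (cst 0)) ?integral0// => x _.
by rewrite /mollify window_set0// measure0 mul0r.
Qed.

Lemma mollify_jordan nu d :
  mollify nu d = (fun x => mollify (jordanP nu) d x - mollify (jordanN nu) d x)%R.
Proof.
apply/funext => x; rewrite /mollify -mulrBl; congr (_ / _)%R.
by rewrite (jordanB nu (measurable_itv `](x - d)%R, x])) fineB ?fin_num_measure.
Qed.

Lemma integrable_mollify_charge nu d (D : set RT) : measurable D ->
  leb.-integrable D (EFin \o mollify nu d).
Proof.
move=> mD; rewrite mollify_jordan; apply: integrableB_EFin => //.
- by apply: (integrableS measurableT mD) => //; exact: integrable_mollify.
- by apply: (integrableS measurableT mD) => //; exact: integrable_mollify.
Qed.

Lemma measurable_mollify_charge nu d (D : set RT) : measurable_fun D (mollify nu d).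
Proof.
by rewrite mollify_jordan; apply: measurable_funB; exact: measurable_mollify.
Qed.

Definition smooth m d : {finite_measure set RT -> \bar R} :=
  @density _ RT R leb _ (mollify_ge0 m d) (integrable_mollify m d).

Lemma smoothE m d (A : set R) : smooth m d A = \int[leb]_(x in A) (mollify m d x)%:E.
Proof. by []. Qed.

Lemma smoothT m d : (0 < d)%R -> smooth m d setT = m setT.
Proof. by move=> d0; rewrite smoothE integral_mollify. Qed.

Lemma integral_smooth m d (D : set RT) (phi : RT -> \bar R) :
  measurable D -> measurable_fun D phi ->
  \int[smooth m d]_(x in D) phi x = \int[leb]_(x in D) (phi x * (mollify m d x)%:E).
Proof. exact: integral_density. Qed.

Lemma ge0_integral_smooth m d (F : R -> \bar R) : (0 < d)%R ->
  measurable_fun setT F -> (forall x, 0 <= F x) ->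
  \int[smooth m d]_x F x = \int[m]_y \int[leb]_(x in `[y, (y + d)%R[) (d^-1%:E * F x).
Proof. by move=> d0 mF F0; rewrite integral_smooth// ge0_integral_mollify. Qed.

Lemma le_integral_smooth m d (F G : R -> \bar R) : (0 < d)%R ->
  measurable_fun setT F -> (forall x, 0 <= F x) ->
  (forall y x, (y <= x < y + d)%R -> F x <= G y) ->
  \int[smooth m d]_x F x <= \int[m]_y G y.
Proof.
move=> d0 mF F0 FG; have dV0 : 0 <= d^-1%:E :> \bar R by rewrite lee_fin invr_ge0 ltW.
have G0 y : 0 <= G y by apply: le_trans (F0 y) (FG y y _); rewrite lexx ltrDl.
rewrite ge0_integral_smooth//; apply: ge0_le_integralT => [y _|//|y _].
  by apply: integral_ge0 => x _; rewrite mule_ge0.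
apply: (@le_trans _ _ (\int[leb]_(x in `[y, (y + d)%R[) cst (d^-1%:E * G y) x)).
  apply: ge0_le_integral => //.
  - by move=> x _; rewrite mule_ge0.
  - by apply: measurable_funTS; exact: measurable_funeM.
  - by move=> x /=; rewrite in_itv/= => /FG Fxy; rewrite lee_wpmul2l.
rewrite integral_cst// [X in _ * X]lebesgue_measure_right_window//.
by rewrite muleAC -EFinM mulVf ?mul1e// gt_eqF.
Qed.

Lemma lebesgue_measure_overlap d x y : (0 < d)%R ->
  leb (`[y, (y + d)%R[ `&` `]-oo, x]) = leb (`[y, +oo[ `&` `](x - d)%R, x]).
Proof.
move=> d0; have [xdy|yxd] := ltP (x - d)%R y.
  by congr (leb _); apply/seteqP; split => z /=; rewrite !in_itv/=; lra.
rewrite (setIidl (_ : _ `<=` _)); last by move=> z /=; rewrite !in_itv/=; lra.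
rewrite (setIidr (_ : _ `<=` _)); last by move=> z /=; rewrite !in_itv/=; lra.
by rewrite lebesgue_measure_right_window// lebesgue_measure_window.
Qed.

Lemma window_integrable_cumul m d x : (0 < d)%R ->
  leb.-integrable `](x - d)%R, x] (EFin \o cumul m).
Proof.
move=> d0; apply: (@window_integrable_bounded _ _ _ d0 _ (fine (m setT))).
  exact: measurable_cumul.
by move=> t _; exact: normr_cumul_le.
Qed.

(* Both sides average the lengths of [`[y, y + d[ `&` `]-oo, x]] over [m]. *)
Lemma cumul_smooth m d x : (0 < d)%R -> cumul (smooth m d) x = lavg d (cumul m) x.
Proof.
move=> d0; apply: EFin_inj; rewrite EFin_cumul.
have dV0 : 0 <= d^-1%:E :> \bar R by rewrite lee_fin invr_ge0 ltW.
have mindic (A : set RT) : measurable A -> measurable_fun setT (EFin \o \1_A : RT -> \bar R).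
  by move=> mA; apply/measurable_EFinP; exact: measurable_indic.
have integral_cut (A B : set RT) : measurable A -> measurable B ->
    \int[leb]_(t in B) (d^-1%:E * (\1_A t)%:E) = d^-1%:E * leb (B `&` A).
  move=> mA mB; rewrite ge0_integralZl//; last by apply: measurable_funTS; exact: mindic.
  by congr (_ * _); rewrite setIC; exact: integral_indic.
transitivity (\int[m]_y (d^-1%:E * leb (`[y, (y + d)%R[ `&` `]-oo, x]))).
  rewrite -(integral_indicT (smooth m d) (measurable_itv _)).
  by rewrite ge0_integral_smooth//; [apply: eq_integral => y _; exact: integral_cut|exact: mindic].
transitivity (\int[leb]_t ((d^-1%:E * (\1_(`](x - d)%R, x]) t)%:E) *
    m [set y | `[0%R, +oo[%classic (t - y)%R])).
  rewrite (ge0_integral_difference leb m (measurable_itv _)); last 2 first.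
  - by apply: measurable_funeM; exact: mindic.
  - by move=> t; rewrite mule_ge0.
  by apply: eq_integral => y _; rewrite difference_ray integral_cut// lebesgue_measure_overlap.
have icumul := window_integrable_cumul m x d0.
rewrite /lavg EFinM fineK ?(integrable_fin_num _ icumul)// -ge0_integralZl//.
- rewrite [RHS]integral_mkcond; apply: eq_integral => t _; rewrite patchE indicE.
  by rewrite -cumul_difference -EFin_cumul; case: ifPn; rewrite ?mule1 // mule0 mul0e.
- by apply/measurable_EFinP; exact: measurable_cumul.
- by move=> t _; rewrite lee_fin cumul_ge0.
Qed.

End mollification.

Section bounded_variation.
Context {R : realType}.
Local Notation RT := (measurableTypeR R).
Local Notation leb := (@lebesgue_measure R).
Implicit Types (m p n : {finite_measure set RT -> \bar R}) (a b c d K x y : R) (phi : R -> R).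

Lemma lebesgue_measure_I_lty a b : (leb (I a b) < +oo)%E.
Proof. by rewrite /I lebesgue_measure_itv/=; case: ifP; rewrite ltry. Qed.

Lemma bounded_L1 a b (f : R -> R) (M : R) : measurable_fun (I a b) f ->
  (forall x, I a b x -> `|f x| <= M) -> L1 a b f.
Proof. exact: (integrable_bounded (measurable_I a b) (lebesgue_measure_I_lty a b)). Qed.

(* The function of bounded variation with derivative [p - n] and limit [c] at [-oo]. *)
Definition bvfun c p n x : R := c + (cumul p x - cumul n x).

Lemma measurable_bvfun c p n D : measurable_fun D (bvfun c p n).
Proof.
by apply: measurable_funD => //; apply: measurable_funB; exact: measurable_cumul.
Qed.

Lemma bvfun_bounded c p n x : `|bvfun c p n x| <= `|c| + (fine (p setT) + fine (n setT)).
Proof.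
rewrite (le_trans (ler_normD _ _))// lerD2l (le_trans (ler_normB _ _))//.
by apply: lerD; exact: normr_cumul_le.
Qed.

Lemma bvfun_L1 a b c p n : L1 a b (bvfun c p n).
Proof. by apply: bounded_L1 => [|x _]; [exact: measurable_bvfun|exact: bvfun_bounded]. Qed.

Lemma window_integrable_bvfun c p n d x : 0 < d ->
  leb.-integrable `]x - d, x] (EFin \o bvfun c p n).
Proof.
move=> d0; apply: (window_integrable_bounded d0); first exact: measurable_bvfun.
by move=> t _; exact: bvfun_bounded.
Qed.

Lemma cumulB m x y : x <= y -> cumul m y - cumul m x = fine (m `]x, y]%classic).
Proof.
move=> xy; have -> : `]x, y]%classic = `]-oo, y]%classic `\` `]-oo, x]%classic.
  by apply/seteqP; split => z /=; rewrite !in_itv/=; lra.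
rewrite measureD// ?ltey_eq ?fin_num_measure// setIidr ?fineB ?fin_num_measure//.
by move=> z /=; rewrite !in_itv/=; lra.
Qed.

Lemma bvfun_oscillation c p n d x t : `]x - d, x]%classic t ->
  `|bvfun c p n t - bvfun c p n x| <= fine (p `]x - d, x]%classic) + fine (n `]x - d, x]%classic).
Proof.
rewrite /= in_itv/= => /andP[xdt tx].
have incr m : 0 <= cumul m x - cumul m t <= fine (m `]x - d, x]%classic).
  rewrite cumulB// fine_ge0//=; apply: fine_le; rewrite ?fin_num_measure//.
  by apply: le_measure; rewrite ?inE// => z /=; rewrite !in_itv/=; lra.
by have := incr p; have := incr n; rewrite /bvfun ler_norml; lra.
Qed.

Lemma cvg_cumul_at_right m a : m `]-oo, a]%classic = 0%E -> cumul m x @[x --> a^'+] --> 0.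
Proof.
move=> ma.
have : m `]a, x]%classic @[x --> a^'+] --> 0%E.
  apply: (@cvg_measure_at_right0 _ _ _ m (fun x => `]a, x]%classic)) => //.
    by move=> x y xy z /=; rewrite !in_itv/=; lra.
  apply/seteqP; split=> // x xall.
  have ax : a < x by have /= := xall 0%N Logic.I; rewrite in_itv/=; lra.
  have [n anx] := ltr_add_invr ax.
  by have := xall n Logic.I; rewrite /= in_itv/= ax/= leNgt anx.
move=> /fine_cvgP[_]; apply: cvg_trans; apply: near_eq_cvg; near=> x => /=.
rewrite -cumulB; last by near: x; exact: nbhs_right_ge.
by rewrite {2}/cumul ma subr0.
Unshelve. all: by end_near. Qed.

Lemma lavg_bvfun c p n d x : 0 < d -> lavg d (bvfun c p n) x = bvfun c (smooth p d) (smooth n d) x.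
Proof.
move=> d0; have icumul m := window_integrable_cumul m x d0.
rewrite /bvfun lavgD// ?lavg_cst// ?lavgB// ?cumul_smooth//.
  exact: (@window_integrable_bounded _ _ _ d0 _ `|c|).
by apply: integrableB_EFin.
Qed.

Lemma test_fun_integrable m a b phi : test_fun a b phi -> m.-integrable (I a b) (EFin \o phi).
Proof.
move=> /test_fun_bounded[M [phiM _ mphi _]].
apply: (@finite_integrable_bounded _ RT _ m _ _ M) => //; first exact: measurable_I.
exact: measurable_funTS.
Qed.

Lemma integrable_mul_derive1_test_fun a b (f : R -> R) phi : L1 a b f -> test_fun a b phi ->
  leb.-integrable (I a b) (EFin \o (fun x => f x * derive1 phi x)).
Proof.
move=> fL1 /test_fun_bounded[M [_ phi'M _ mphi']].
apply: (integrableMl (measurable_I a b) fL1); first exact: measurable_funTS.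
by exists M; split=> [|k Mk x _ /=]; [exact: num_real|exact: le_trans (phi'M x) (ltW Mk)].
Qed.

Lemma integral_cst_mul_derive1_test_fun a b c phi : test_fun a b phi ->
  (\int[leb]_(x in I a b) (c * derive1 phi x)%:E = 0)%E.
Proof.
move=> tphi; have [dphi [cphi' [c' [d' [_ [_ phi0]]]]]] := tphi.
rewrite integral_support; last by move=> x /(test_fun_out tphi)[_ ->]; rewrite mulr0.
under eq_integral do rewrite EFinM.
rewrite integralZl ?(integral_derive1_eq0 dphi cphi' phi0) ?mule0//.
exact: vanishes_outside_integrable (derive1_vanishes_outside phi0).
Qed.

Lemma bvfun_weak_derivative a b c p n phi : test_fun a b phi ->
  (\int[leb]_(x in I a b) (bvfun c p n x * derive1 phi x)%:E =
   - (\int[p]_(x in I a b) (phi x)%:E - \int[n]_(x in I a b) (phi x)%:E))%E.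
Proof.
move=> tphi; have mI := measurable_I a b.
have cumulL1 m : L1 a b (cumul m).
  apply: (@bounded_L1 _ _ _ (fine (m setT))); first exact: measurable_cumul.
  by move=> x _; exact: normr_cumul_le.
have cL1 : L1 a b (cst c) by exact: (@bounded_L1 _ _ _ `|c|).
have imul f fL1 := @integrable_mul_derive1_test_fun a b f phi fL1 tphi.
under eq_integral do rewrite /bvfun mulrDl mulrBl.
rewrite (integralD_EFin mI (imul _ cL1)); last first.
  exact: integrableB_EFin mI (imul _ (cumulL1 p)) (imul _ (cumulL1 n)).
rewrite (integralB_EFin mI (imul _ (cumulL1 p)) (imul _ (cumulL1 n))).
rewrite integral_cst_mul_derive1_test_fun// add0e !integral_cumul_test_fun//.
by rewrite oppeK fin_num_oppeB// (integrable_fin_num mI (test_fun_integrable n tphi)).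
Qed.

Lemma W11_lavg_bvfun a b c p n d : 0 < d ->
  W11 a b (lavg d (bvfun c p n)) (fun x => mollify p d x - mollify n d x).
Proof.
move=> d0; have -> : lavg d (bvfun c p n) = bvfun c (smooth p d) (smooth n d).
  by apply/funext => x; exact: lavg_bvfun.
have mI := measurable_I a b.
have imollify m : leb.-integrable (I a b) (EFin \o mollify m d).
  by apply: (integrableS measurableT) => //; exact: integrable_mollify.
split; first exact: bvfun_L1.
split; first exact: integrableB_EFin.
move=> phi tphi; rewrite bvfun_weak_derivative//; congr (- _)%E.
have [M [phiM _ mphi _]] := test_fun_bounded tphi.
have iphi m : leb.-integrable (I a b) (EFin \o (fun x => mollify m d x * phi x)).
  apply: (integrableMl mI (imollify m)); first exact: measurable_funTS.
  by exists M; split=> [|k Mk x _ /=]; [exact: num_real|exact: le_trans (phiM x) (ltW Mk)].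
under [RHS]eq_integral do rewrite mulrBl.
rewrite (integralB_EFin mI (iphi p) (iphi n)).
have mphiE : measurable_fun (I a b) (EFin \o phi).
  by apply/measurable_EFinP; exact: measurable_funTS.
rewrite (integral_smooth p d mI mphiE) (integral_smooth n d mI mphiE).
by congr (_ - _)%E; apply: eq_integral => x _; rewrite mulrC EFinM.
Qed.

Lemma BV_representation a b (u : R -> R) (Du : sm) : a < b -> BVder a b u Du ->
  exists c, {ae leb, forall x, I a b x -> u x = bvfun c (jordanP Du) (jordanN Du) x}.
Proof.
move=> ab [uL1 [_ uDu]]; pose w := bvfun 0 (jordanP Du) (jordanN Du).
have mI := measurable_I a b.
have uwL1 : L1 a b (fun x => u x - w x) by apply: integrableB_EFin => //; exact: bvfun_L1.
have [phi tphi|c uwc] := du_Bois_Reymond ab uwL1.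
  under eq_integral do rewrite mulrBl.
  rewrite integralB_EFin//; last 2 first.
  - exact: integrable_mul_derive1_test_fun.
  - by apply: integrable_mul_derive1_test_fun => //; exact: bvfun_L1.
  rewrite uDu// bvfun_weak_derivative// -[cint Du (I a b) phi]/(_ - _)%E subee//.
  by rewrite fin_numN fin_numB !(integrable_fin_num mI (test_fun_integrable _ tphi)).
exists c; apply: aeS uwc => x /[apply] <-.
by rewrite /bvfun /w /bvfun add0r subrK.
Qed.

Lemma ae_le_at_right a b (f : R -> R) K (l : R) : a < b ->
  {ae leb, forall x, I a b x -> `|f x| <= K} -> f x @[x --> a^'+] --> l -> `|l| <= K.
Proof.
move=> ab fK fl; rewrite leNgt; apply/negP => Kl.
have : \forall x \near a^'+, K < `|f x| /\ x < b.
  near=> x; split; last by near: x; exact: nbhs_right_lt.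
  have : `|l - f x| < `|l| - K by near: x; move/cvgrPdist_lt: fl; apply; rewrite subr_gt0.
  by have := ler_normD (l - f x) (f x); rewrite subrK; lra.
move=> [r /= r0 rP]; pose s := Num.min r (b - a).
have s0 : 0 < s by rewrite lt_min r0 subr_gt0.
have leJ : (0 < leb `]a, (a + s)%R[)%E.
  by rewrite lebesgue_measure_itv/= lte_fin ltrDl s0 -EFinB lte_fin; lra.
have [x] := ae_exists fK (measurable_itv _) leJ.
rewrite /= in_itv/= => /andP[ax xas].
have sr : s <= r by rewrite ge_min lexx.
have [] : K < `|f x| /\ x < b.
  by apply: rP => //; rewrite /ball_/= distrC ger0_norm; lra.
by move=> Kfx xb; rewrite leNgt Kfx /I/= in_itv/= ax xb => /(_ isT).
Unshelve. all: by end_near. Qed.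

Lemma bvfun_le_left a b c p n K : a < b ->
  p `]-oo, a]%classic = 0%E -> n `]-oo, a]%classic = 0%E ->
  {ae leb, forall x, I a b x -> `|bvfun c p n x| <= K} ->
  {ae leb, forall x, x < b -> `|bvfun c p n x| <= K}.
Proof.
move=> ab pa na bvK; have cK : `|c| <= K.
  apply: (ae_le_at_right ab bvK); rewrite -[X in _ --> X]addr0 -[X in _ --> _ + X]subr0.
  by apply: cvgD; [exact: cvg_cst|apply: cvgB; exact: cvg_cumul_at_right].
apply: aeS bvK => x bvK xb; have [xa|ax] := leP x a; last by apply: bvK; rewrite /I/= in_itv/= ax.
have cumul0 m : m `]-oo, a]%classic = 0%E -> cumul m x = 0.
  move=> ma; rewrite /cumul (@subset_measure0 _ _ _ m _ `]-oo, a]%classic)//.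
  by move=> z /=; rewrite !in_itv/=; lra.
by rewrite /bvfun !cumul0// subrr addr0.
Qed.

Lemma lavg_bvfun_le b c p n K d x : 0 < d ->
  {ae leb, forall x, x < b -> `|bvfun c p n x| <= K} -> x < b ->
  `|lavg d (bvfun c p n) x| <= K.
Proof.
move=> d0 bvK xb; rewrite -[lavg _ _ _]subr0; apply: lavg_dist_le => //.
  exact: window_integrable_bvfun.
apply: aeS bvK => t bvK.
by rewrite /= in_itv/= subr0 => ?; apply: bvK; lra.
Qed.

Lemma lavg_bvfun_dist_le a b c p n d : 0 < d ->
  (\int[leb]_(x in I a b) (`|lavg d (bvfun c p n) x - bvfun c p n x|)%:E
   <= d%:E * (p setT + n setT))%E.
Proof.
move=> d0; rewrite ge0_muleDr// -!integral_window_mass//.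
rewrite -(ge0_integralD leb measurableT)//; [|exact: measurable_window_mass..].
apply: ge0_le_integralT => [x _|x|x _]; [by rewrite lee_fin|by rewrite adde_ge0|].
rewrite -(fineK (fin_num_measure p _ (measurable_itv `](x - d), x]))).
rewrite -(fineK (fin_num_measure n _ (measurable_itv `](x - d), x]))).
rewrite -EFinD lee_fin; apply: lavg_dist_le => //.
  exact: window_integrable_bvfun.
by apply: aeW => t; exact: bvfun_oscillation.
Qed.

End bounded_variation.

Section flat_distance.
Context {R : realType}.
Local Notation RT := (measurableTypeR R).
Implicit Types (m : {finite_measure set RT -> \bar R}) (a b d x y : R) (phi psi : R -> R).
Implicit Types (nu gamma : @sm R).

Section lipschitz.
Variables (psi : R -> R) (M : R).
Hypotheses (psiM : forall x, `|psi x| <= M) (mpsi : measurable_fun setT psi).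
Hypothesis psi_lip : forall x y, `|psi x - psi y| <= `|x - y|.

Let ipsi m : m.-integrable setT (EFin \o psi).
Proof. exact: finite_integrable_bounded. Qed.

(* Adding [M] makes the integrand nonnegative, so that Tonelli applies. *)
Lemma Rintegral_smooth_le m d : 0 < d ->
  \int[smooth m d]_x psi x <= \int[m]_x psi x + d * fine (m setT).
Proof.
move=> d0; have ishift (m' : {finite_measure set RT -> \bar R}) k :
    m'.-integrable setT (EFin \o (fun x => psi x + k)).
  have icst := finite_measure_integrable_cst m' (- k) measurableT.
  have := integrableB_EFin measurableT (ipsi m') icst.
  by apply: eq_integrable => // x _; rewrite /= opprK.
have int_shift (m' : {finite_measure set RT -> \bar R}) k :
    \int[m']_x (psi x + k) = \int[m']_x psi x + k * fine (m' setT).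
  rewrite -(Rintegral_cst m' measurableT) -RintegralD//; first exact: ipsi.
  exact: finite_measure_integrable_cst.
have : \int[smooth m d]_x (psi x + M) <= \int[m]_x (psi x + (M + d)).
  apply: fine_le; [exact: integrable_fin_num (ishift _ _)..|].
  apply: le_integral_smooth => //.
  - by apply/measurable_EFinP; exact: measurable_funD.
  - by move=> x; rewrite lee_fin; have := psiM x; rewrite ler_norml; lra.
  - move=> y x /andP[yx xyd]; rewrite lee_fin; have := psi_lip x y.
    by rewrite (ger0_norm (_ : 0 <= x - y)) ?subr_ge0// ler_norml; lra.
by rewrite !int_shift smoothT//; lra.
Qed.

End lipschitz.

Lemma Rintegral_smooth_dist m d psi (M : R) : 0 < d ->
  (forall x, `|psi x| <= M) -> measurable_fun setT psi ->
  (forall x y, `|psi x - psi y| <= `|x - y|) ->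
  `|\int[smooth m d]_x psi x - \int[m]_x psi x| <= d * fine (m setT).
Proof.
move=> d0 psiM mpsi psi_lip.
have ipsi m' := finite_integrable_bounded m' measurableT mpsi (fun x _ => psiM x).
have RintegralN (m' : {finite_measure set RT -> \bar R}) :
    \int[m']_x (- psi x) = - \int[m']_x psi x.
  under eq_Rintegral do rewrite -mulN1r.
  by rewrite RintegralZl ?mulN1r//; exact: ipsi.
have up := Rintegral_smooth_le psiM mpsi psi_lip m d0.
have := @Rintegral_smooth_le (\- psi) M _ _ _ m d d0; rewrite !RintegralN => lo.
rewrite ler_distl; apply/andP; split; last exact: up.
rewrite -lerN2 opprB addrC; apply: lo; [by move=> x; rewrite normrN|exact: measurable_funN|].
by move=> x y; rewrite /= opprK addrC [leRHS]distrC; exact: psi_lip.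
Qed.

Definition clamp a b x : R := Num.max a (Num.min x b).

Lemma clamp_itv a b x : a <= b -> a <= clamp a b x <= b.
Proof. by move=> ab; rewrite /clamp le_max lexx/= ge_max ab ge_min lexx orbT. Qed.

Lemma clamp_id a b x : a <= x <= b -> clamp a b x = x.
Proof. by move=> /andP[ax xb]; rewrite /clamp (min_idPl xb); apply/max_idPr. Qed.

Lemma clamp_lipschitz a b x y : `|clamp a b x - clamp a b y| <= `|x - y|.
Proof.
wlog xy : x y / x <= y => [lip|].
  by have [/lip//|/ltW/lip] := leP x y; rewrite distrC [leRHS]distrC.
rewrite [leRHS]distrC (ger0_norm (_ : 0 <= y - x)) ?subr_ge0// ler_norml.
rewrite /clamp; have [xb|bx] := leP x b; have [yb|by_] := leP y b.
- by case: (leP a x) => ax; case: (leP a y) => ay; lra.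
- by case: (leP a x) => ax; case: (leP a b) => ab; lra.
- lra.
- by rewrite subrr; lra.
Qed.

Lemma clamp_out a b x : a <= b -> ~ I a b x -> clamp a b x = a \/ clamp a b x = b.
Proof.
move=> ab; rewrite /I/= in_itv/= /clamp => /negP; rewrite negb_and -!leNgt => /orP[xa|bx].
  by left; apply/max_idPl; rewrite ge_min xa.
by right; rewrite (min_idPr bx); exact/max_idPr.
Qed.

Lemma flat_test_clamp a b phi : a <= b -> flat_test a b phi ->
  let psi := phi \o clamp a b in
  [/\ forall x, `|psi x| <= 1, forall x y, `|psi x - psi y| <= `|x - y|,
    measurable_fun setT psi, {in I a b, phi =1 psi} & forall x, ~ I a b x -> psi x = 0].
Proof.
move=> ab [phia [phib [phi1 phi_lip]]] psi.
have psi_lip x y : `|psi x - psi y| <= `|x - y|.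
  by rewrite (le_trans (phi_lip _ _ _ _))// ?clamp_itv// clamp_lipschitz.
split=> //.
- by move=> x; rewrite phi1// clamp_itv.
- apply: continuous_measurable_fun => x; apply/cvgrPdist_le => e e0.
  by exists e => //= y xy; rewrite (le_trans (psi_lip _ _))// ltW.
- move=> x; rewrite inE /I/= in_itv/= => /andP[/ltW ax /ltW xb].
  by rewrite /psi/= clamp_id// ax.
- by move=> x /(clamp_out ab); rewrite /psi/= => -[] ->.
Qed.

Lemma flatdist_ge0 a b nu gamma : (0 <= flatdist a b nu gamma)%E.
Proof.
apply: ereal_sup_ubound; exists (fun=> 0).
  by split=> //; split=> //; split=> [x _|x y _ _]; rewrite ?subrr normr0.
by rewrite /cint !integral0 !sube0.
Qed.

Lemma flatdist_smooth_le a b gamma nu d : 0 < d -> a < b ->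
  (forall A : set R, measurable A -> A `<=` I a b ->
    nu A = smooth (jordanP gamma) d A - smooth (jordanN gamma) d A)%E ->
  (flatdist a b nu gamma <= d%:E * variation gamma setT)%E.
Proof.
move=> d0 ab nuE; apply: ge_ereal_sup => _ [phi tphi <-].
have [psi1 psi_lip mpsi phiE psi0] := flat_test_clamp (ltW ab) tphi.
have mI := measurable_I a b.
have mphi : measurable_fun (I a b) phi.
  by apply: (eq_measurable_fun _ _ (measurable_funTS mpsi)) => x /phiE.
have phi1 x : I a b x -> `|phi x| <= 1 by move=> Ix; rewrite phiE ?inE.
have int_psi m : (\int[m]_(x in I a b) (phi x)%:E = (\int[m]_x (phi \o clamp a b) x)%:E)%E.
  transitivity (\int[m]_(x in I a b) ((phi \o clamp a b) x)%:E)%E.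
    by apply: eq_integral => x /phiE ->.
  rewrite integral_support; last by move=> x /psi0 /= ->.
  rewrite fineK//; apply: integrable_fin_num => //.
  exact: (@finite_integrable_bounded _ RT _ m _ _ 1 measurableT mpsi (fun x _ => psi1 x)).
rewrite (cint_decomp nuE mI mphi phi1) -[cint gamma (I a b) phi]/(_ - _)%E !int_psi.
rewrite variationE -(fineK (fin_num_measure (jordanP gamma) _ measurableT)).
rewrite -(fineK (fin_num_measure (jordanN gamma) _ measurableT)).
have := Rintegral_smooth_dist (jordanP gamma) d0 psi1 mpsi psi_lip.
have := Rintegral_smooth_dist (jordanN gamma) d0 psi1 mpsi psi_lip.
by rewrite -!(EFinB, EFinD, EFinM) lee_fin !ler_norml; lra.
Qed.

End flat_distance.

Section nonlocal_energy.
Context {R : realType}.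
Local Notation RT := (measurableTypeR R).
Local Notation leb := (@lebesgue_measure R).
Implicit Types (m lam : {finite_measure set RT -> \bar R}) (nu : @sm R).
Implicit Types (a b d e r t x : R) (B : seq R).
Local Open Scope ereal_scope.

Definition layer a b r : set R := ~` `](a + r)%R, (b - r)%R[.

Lemma measurable_layer a b r : measurable (layer a b r : set RT).
Proof. by apply: measurableC; exact: measurable_itv. Qed.

Lemma layerE a b r x : layer a b r x = ~ (a + r < x < b - r)%R.
Proof. by rewrite /layer /setC/= in_itv. Qed.

Lemma le_layer a b r s : (r <= s)%R -> layer a b r `<=` layer a b s.
Proof. by move=> rs x; rewrite !layerE; lra. Qed.

Lemma cvg_layer_mass m a b : m (~` I a b) = 0 -> m (layer a b r) @[r --> 0%R^'+] --> 0.
Proof.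
move=> mI0; have mI := measurable_I a b.
have mlayer r := measurable_layer a b r.
have massE r : m (layer a b r) = m (layer a b r `&` I a b).
  rewrite (measureDI m (mlayer r) mI) (@subset_measure0 _ _ _ m _ (~` I a b)) ?add0e//.
  - exact: measurableD.
  - exact: measurableC.
rewrite (_ : (fun r => _) = (fun r => m (layer a b r `&` I a b))); last exact/funext.
apply: (@cvg_measure_at_right0 _ _ _ m (fun r => layer a b r `&` I a b)).
- by move=> r; exact: measurableI.
- by move=> r s rs; apply: setSI; exact: le_layer.
apply/seteqP; split=> // x xall.
have [_] := xall 0%N Logic.I; rewrite /I/= in_itv/= => /andP[ax xb].
pose s := Num.min (x - a)%R (b - x)%R; have s0 : (0 < s)%R by rewrite lt_min !subr_gt0 ax.
have [n sn] := ltr_add_invr s0; have [] := xall n Logic.I.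
rewrite layerE => + _; apply; move: sn; rewrite lt_min !add0r => /andP[na nb].
by rewrite -ltrBrDl na ltrBrDr -ltrBrDl nb.
Qed.

(* Dominates the inverse length of [Ieps e x `&` I a b]: the window is truncated
   by at most one half, and only when [x] is within [e] of an endpoint. *)
Definition window_weight a b e x : R := ((2 * e)^-1 * (1 + \1_(layer a b e) x))%R.

Lemma window_weight_ge0 a b e x : (0 < e)%R -> (0 <= window_weight a b e x)%R.
Proof. by move=> e0; rewrite mulr_ge0 ?invr_ge0 ?mulr_ge0 ?addr_ge0// ltW. Qed.

Lemma measurable_window_weight a b e : measurable_fun setT (window_weight a b e).
Proof.
apply: measurable_funM => //; apply: measurable_funD => //.
by apply: measurable_indic; exact: measurable_layer.
Qed.

Lemma inv_window_length_le a b e x : (0 < e)%R -> (2 * e < b - a)%R -> I a b x ->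
  ((fine (leb (Ieps e x `&` I a b)))^-1 <= window_weight a b e x)%R.
Proof.
move=> e0 eab; rewrite /I/= in_itv/= => /andP[ax xb].
pose l := Num.max (x - e)%R a; pose r := Num.min (x + e)%R b.
have -> : Ieps e x `&` `]a, b[%classic = `]l, r[%classic.
  apply/seteqP; split => t /=; rewrite /Ieps/= !in_itv/= /l /r gt_max lt_min; lra.
have lr : (l < r)%R by rewrite /l /r gt_max !lt_min; lra.
rewrite lebesgue_measure_itv/= lte_fin lr -EFinB/= /window_weight indicE.
have [xlayer|xlayer] := boolP (x \in layer a b e).
  have elr : (e <= r - l)%R.
    by rewrite /r /l; case: (leP (x + e)%R b) => ?; case: (leP (x - e)%R a) => ?; lra.
  have -> : ((2 * e)^-1 * (1 + true%:R) = e^-1 :> R)%R.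
    by rewrite -[(1 + _)%R]/2%:R invfM mulrAC mulVf ?mul1r.
  by rewrite lef_pV2 ?posrE// subr_gt0.
move: xlayer; rewrite notin_setE layerE => /contrapT/andP[aex xbe].
rewrite addr0 mulr1 lef_pV2 ?posrE ?mulr_gt0 ?subr_gt0//.
by rewrite /r /l; case: (leP (x + e)%R b) => ?; case: (leP (x - e)%R a) => ?; lra.
Qed.

Lemma Ieps_difference e x : Ieps e x = [set t | `](- e)%R, e[%classic (x - t)%R].
Proof. by apply/seteqP; split => t /=; rewrite /Ieps/= !in_itv/=; lra. Qed.

Lemma integral_window_weight_le a b e t : (0 < e)%R ->
  \int[leb]_(x in Ieps e t) (window_weight a b e x)%:E <= (1 + \1_(layer a b (2 * e)) t)%:E.
Proof.
move=> e0; set z := (1 + _)%R.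
apply: (@le_trans _ _ (\int[leb]_(x in Ieps e t) cst ((2 * e)^-1 * z)%:E x)).
  apply: ge0_le_integral => //; first exact: measurable_itv.
  - by move=> x _; rewrite lee_fin window_weight_ge0.
  - by apply/measurable_EFinP; apply: measurable_funTS; exact: measurable_window_weight.
  - move=> x /=; rewrite /Ieps/= in_itv/= => xt; rewrite lee_fin /window_weight ler_wpM2l//.
      by rewrite invr_ge0 mulr_ge0// ltW.
    rewrite /z lerD2l !indicE ler_nat; have [tin|tnin] := boolP (t \in layer a b (2 * e)).
      by case: (_ \in _).
    rewrite memNset// => xlayer; move: tnin; rewrite notin_setE; apply.
    by move: xlayer; rewrite !layerE; lra.
rewrite integral_cst//; last exact: measurable_itv.
rewrite [X in _ * X](_ : _ = (2 * e)%:E); last first.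
  by apply: etrans (lebesgue_measure_bounded_itv _ _ _) _; [|congr EFin]; lra.
by rewrite -EFinM lee_fin mulrAC mulVf ?mul1r// mulf_neq0 ?gt_eqF.
Qed.

Lemma integral_weighted_mass_le m a b e : (0 < e)%R ->
  \int[leb]_x ((window_weight a b e x)%:E * m (Ieps e x)) <=
  \int[m]_t (1 + \1_(layer a b (2 * e)) t)%:E.
Proof.
move=> e0; under eq_integral do rewrite Ieps_difference.
rewrite (ge0_integral_difference leb m (measurable_itv _)); last 2 first.
- by apply/measurable_EFinP; exact: measurable_window_weight.
- by move=> x; rewrite lee_fin window_weight_ge0.
apply: ge0_le_integralT => [t _|t|t _].
- by apply: integral_ge0 => x _; rewrite lee_fin window_weight_ge0.
- by rewrite lee_fin addr_ge0.
apply: le_trans (integral_window_weight_le a b t e0).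
rewrite le_eqVlt; apply/predU1P; left; congr (integral leb _ _).
by apply/seteqP; split => x /=; rewrite /Ieps/= !in_itv/=; lra.
Qed.

Lemma integral_weighted_smooth_mass_le lam a b d e : (0 < d)%R -> (0 < e)%R ->
  \int[leb]_x ((window_weight a b e x)%:E * smooth lam d (Ieps e x)) <=
  lam setT + lam (layer a b (2 * e + d)).
Proof.
move=> d0 e0; apply: le_trans (integral_weighted_mass_le (smooth lam d) a b e0) _.
have mlayer r := measurable_layer a b r.
apply: (@le_trans _ _ (\int[lam]_t (1 + \1_(layer a b (2 * e + d)) t)%:E)).
  apply: le_integral_smooth => //.
  - by apply/measurable_EFinP; apply: measurable_funD => //; exact: (measurable_indic (mlayer _)).
  - move=> y x yxd; rewrite lee_fin lerD2l !indicE ler_nat.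
    have [yin|ynin] := boolP (y \in layer a b (2 * e + d)); first by case: (_ \in _).
    rewrite memNset// => xlayer; move: ynin; rewrite notin_setE; apply.
    by move: xlayer; rewrite !layerE; lra.
under eq_integral do rewrite EFinD.
rewrite ge0_integralD//; last by apply/measurable_EFinP; exact: measurable_indic.
by rewrite integral_cst// mul1e integral_indicT.
Qed.

Definition dominated_off B nu lam := forall A : set R, measurable A ->
  (forall q, q \in B -> ~ A q) -> `|nu A| <= lam A.

Section dominated.
Variables (a b c0 d e : R) (B : seq R) (nu : @sm R) (lam : {finite_measure set RT -> \bar R}).
Hypotheses (c0_gt0 : (0 < c0)%R) (d0 : (0 < d)%R) (e0 : (0 < e)%R) (eab : (2 * e < b - a)%R).
Hypothesis nu_lam : dominated_off B nu lam.

Let dV_ge0 : (0 <= d^-1)%R. Proof. by rewrite invr_ge0 ltW. Qed.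

Lemma abs_mollify_le t : (forall q, q \in B -> ~ `](t - d)%R, t]%classic q) ->
  (`|mollify nu d t| <= mollify lam d t)%R.
Proof.
move=> Bt; have mW : measurable (`](t - d)%R, t]%classic : set RT) by exact: measurable_itv.
have := nu_lam mW Bt.
rewrite -(fineK (fin_num_measure nu _ mW)) -(fineK (fin_num_measure lam _ mW)).
by rewrite lee_fin /mollify normrM (ger0_norm dV_ge0); exact: ler_wpM2r.
Qed.

Let avg_ge0 (h : R -> R) x : (0 <= avg a b e h x)%R.
Proof. by rewrite divr_ge0 ?fine_ge0// integral_ge0. Qed.

Lemma avg_mollify_le x : I a b x ->
  (forall q, q \in B -> ~ `](q - e)%R, (q + e + d)%R[%classic x) ->
  (avg a b e (mollify nu d) x)%:E <= (window_weight a b e x)%:E * smooth lam d (Ieps e x).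
Proof.
move=> Ix Bx; have mE : measurable (Ieps e x : set RT) by exact: measurable_itv.
have mEI : measurable (Ieps e x `&` I a b : set RT).
  by apply: measurableI => //; exact: measurable_I.
have mass_le : \int[leb]_(t in Ieps e x `&` I a b) (`|mollify nu d t|)%:E <=
    smooth lam d (Ieps e x).
  apply: (@le_trans _ _ (\int[leb]_(t in Ieps e x `&` I a b) (mollify lam d t)%:E)).
    apply: ge0_le_integral => //.
    - apply/measurable_EFinP; apply: measurableT_comp => //; exact: measurable_mollify_charge.
    - by apply/measurable_EFinP; exact: measurable_mollify.
    - move=> t [+ _]; rewrite /Ieps/= in_itv/= lee_fin => xt.
      apply: abs_mollify_le => q qB /=; rewrite in_itv/= => qt.
      by apply: (Bx q qB); rewrite /= in_itv/=; lra.
  apply: ge0_subset_integral => //.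
  - by apply/measurable_EFinP; exact: measurable_mollify.
  - by move=> t _; rewrite lee_fin mollify_ge0.
have smooth_fin : smooth lam d (Ieps e x) \is a fin_num by exact: fin_num_measure.
rewrite -(fineK smooth_fin) -EFinM lee_fin mulrC.
apply: ler_pM; [by rewrite fine_ge0 ?integral_ge0|by rewrite invr_ge0 fine_ge0| |].
  apply: fine_le => //; rewrite ge0_fin_numE ?integral_ge0//.
  by rewrite (le_lt_trans mass_le)// ltey_eq smooth_fin.
exact: inv_window_length_le.
Qed.

Let hits x : R := (\sum_(q <- B) \1_(`](q - e)%R, (q + e + d)%R[) x)%R.

Let hits_ge0 x : (0 <= hits x)%R.
Proof. by apply: sumr_ge0 => q _; rewrite indicE. Qed.

Let measurable_hits : measurable_fun setT hits.
Proof. by apply: measurable_sum => q; exact: measurable_indic. Qed.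

Let integral_hits : \int[leb]_x (hits x)%:E = ((2 * e + d) * (size B)%:R)%:E.
Proof.
under eq_integral do rewrite /hits -sumEFin.
rewrite ge0_integral_sum//; last first.
  by move=> q; apply/measurable_EFinP; exact: measurable_indic.
have length q : leb `](q - e)%R, (q + e + d)%R[ = (2 * e + d)%:E.
  have qlt : (q - e <= q + e + d)%R.
    by rewrite -addrA lerD2l (@le_trans _ _ 0%R)// ?oppr_le0 ?addr_ge0// ltW.
  by rewrite (lebesgue_measure_bounded_itv _ _ qlt); congr EFin; lra.
rewrite (eq_bigr (fun=> (2 * e + d)%:E)) => [|q _]; last first.
  by rewrite -(length q); exact: (integral_indicT leb (measurable_itv _)).
by rewrite sumEFin big_const_seq count_predT iter_addr_0 mulr_natr.
Qed.

Lemma fc_avg_mollify_le x : I a b x ->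
  (fc c0 (e * avg a b e (mollify nu d) x))%:E <=
  c0%:E * (hits x)%:E + (c0 * e)%:E * ((window_weight a b e x)%:E * smooth lam d (Ieps e x)).
Proof.
move=> Ix; have c0e : (0 <= c0 * e)%R by rewrite mulr_ge0// ltW.
have [/hasP[q qB xq]|/hasPn nB] := boolP (has (fun q => x \in `](q - e)%R, (q + e + d)%R[) B).
  apply: (@le_trans _ _ (c0%:E * (hits x)%:E)); last first.
    by rewrite leeDl// !mule_ge0// lee_fin window_weight_ge0.
  rewrite -EFinM lee_fin /fc ler_pM2l//; apply: (@le_trans _ _ 1%R).
    by rewrite ge_min lexx orbT.
  rewrite /hits (big_rem q)//= indicE mem_setE xq lerDl.
  by apply: sumr_ge0 => r _; rewrite indicE.
apply: (@le_trans _ _ ((c0 * e)%:E * (avg a b e (mollify nu d) x)%:E)).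
  by rewrite -EFinM lee_fin /fc -mulrA ler_pM2l// ge_min lexx.
apply: (@le_trans _ _ ((c0 * e)%:E * ((window_weight a b e x)%:E * smooth lam d (Ieps e x)))).
  by rewrite lee_wpmul2l ?lee_fin//; apply: avg_mollify_le => // q qB; exact/negP/nB.
by rewrite leeDr// -EFinM lee_fin mulr_ge0// ltW.
Qed.

Lemma nonlocal_energy_le :
  \int[leb]_(x in I a b) (fc c0 (e * avg a b e (mollify nu d) x))%:E <=
  (c0 * ((2 * e + d) * (size B)%:R))%:E +
  (c0 * e)%:E * (lam setT + lam (layer a b (2 * e + d))).
Proof.
pose W x : \bar R := (window_weight a b e x)%:E * smooth lam d (Ieps e x).
have W0 x : 0 <= W x by rewrite mule_ge0// lee_fin window_weight_ge0.
have mW : measurable_fun setT W.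
  apply: emeasurable_funM; first by apply/measurable_EFinP; exact: measurable_window_weight.
  have := measurable_mass_difference (smooth lam d) (measurable_itv `](- e)%R, e[).
  by apply: eq_measurable_fun => x _; rewrite Ieps_difference.
have c0E : 0 <= c0%:E by rewrite lee_fin ltW.
have c0e : 0 <= (c0 * e)%:E by rewrite lee_fin mulr_ge0// ltW.
have mhits : measurable_fun setT (EFin \o hits) by exact/measurable_EFinP.
apply: (@le_trans _ _ (\int[leb]_x (c0%:E * (hits x)%:E + (c0 * e)%:E * W x))).
  apply: ge0_le_integralT => [x _|x|x Ix]; last exact: fc_avg_mollify_le.
    by rewrite lee_fin mulr_ge0 ?(ltW c0_gt0)// le_min ler01 andbT mulr_ge0// ltW.
  by apply: adde_ge0; apply: mule_ge0; rewrite ?lee_fin.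
rewrite ge0_integralD//; [| |exact: measurable_funeM| |exact: measurable_funeM].
- rewrite EFinM !ge0_integralZl//; last by move=> x _; rewrite lee_fin.
  rewrite [X in c0%:E * X]integral_hits leeD2l// lee_wpmul2l//.
  exact: integral_weighted_smooth_mass_le.
- by move=> x _; rewrite mule_ge0// lee_fin.
- by move=> x _; rewrite mule_ge0.
Qed.

End dominated.
End nonlocal_energy.

Section mollified_charges.
Context {R : realType}.
Local Notation RT := (measurableTypeR R).
Local Notation leb := (@lebesgue_measure R).
Implicit Types (a b d : R) (nu gamma : @sm R).
Local Open Scope ereal_scope.

Lemma integrable_mollify_patch a b nu d : leb.-integrable setT (EFin \o (mollify nu d \_ (I a b))).
Proof.
rewrite -restrict_EFin; apply/integrable_restrict; first exact: measurable_I.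
  by [].
by rewrite setTI; apply: integrable_mollify_charge; exact: measurable_I.
Qed.

Definition mollified_charge a b nu d : @sm R := induced_charge (integrable_mollify_patch a b nu d).

Lemma mollified_chargeE a b nu d (A : set R) :
  mollified_charge a b nu d A = \int[leb]_(x in A `&` I a b) (mollify nu d x)%:E.
Proof. exact: integral_patch_EFin. Qed.

Lemma flatdist_mollified_charge_le a b gamma d : (0 < d)%R -> (a < b)%R ->
  flatdist a b (mollified_charge a b gamma d) gamma <= d%:E * variation gamma setT.
Proof.
move=> d0 ab; apply: flatdist_smooth_le => // A mA AI.
have iA (m : {finite_measure set RT -> \bar R}) :
    leb.-integrable (A : set RT) (EFin \o mollify m d).
  by apply: (integrableS measurableT) => //; exact: integrable_mollify.
rewrite mollified_chargeE (setIidl AI) !smoothE -integralB_EFin//.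
by apply: eq_integral => x _; rewrite mollify_jordan.
Qed.

Lemma cvg0_sqr_le (f : R -> \bar R) (M : R) :
  (\forall e \near 0%R^'+, 0 <= f e <= (e ^+ 2)%:E * M%:E) -> f e @[e --> 0%R^'+] --> 0.
Proof.
move=> f_le; apply: (@squeeze_cvge _ _ _ R (cst 0) f (fun e => (e ^+ 2)%:E * M%:E)) => //.
  exact: cvg_cst.
rewrite -[X in _ --> X](mul0e M%:E); apply: cvgeZr => //.
apply: cvg_EFin; first exact: nearW.
rewrite [X in _ --> X](_ : 0%R = 0 ^+ 2)%R; last by rewrite expr0n.
by apply: cvg_at_right_filter; exact: (@exprn_continuous R 2 0%R).
Qed.

Lemma cvg_layer_width : (2 * e + e ^+ 2 : R)%R @[e --> 0%R^'+] --> 0%R^'+.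
Proof.
move=> P [r /= r0 rP]; suff : \forall e \near 0%R^'+, P (2 * e + e ^+ 2)%R by [].
near=> e; have e0 : (0 < e)%R by near: e; exact: nbhs_right_gt.
have e1 : (e < 1)%R by near: e; exact: nbhs_right_lt.
have er : (e < r / 3)%R by near: e; apply: nbhs_right_lt; rewrite divr_gt0.
have ee : (e ^+ 2 <= e)%R by rewrite expr2 ler_piMr// ltW.
have e20 : (0 < e ^+ 2)%R by rewrite exprn_gt0.
apply: rP; last by rewrite /=; lra.
by rewrite /ball_/= distrC subr0 gtr0_norm; lra.
Unshelve. all: by end_near. Qed.

Lemma cvg_energy_bound a b (k n : R) (V : \bar R) (lam : {finite_measure set RT -> \bar R}) :
  V \is a fin_num -> lam (~` I a b) = 0 ->
  V + ((k * ((2 + e) * n))%:E + k%:E * (lam setT + lam (layer a b (2 * e + e ^+ 2))))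
    @[e --> 0%R^'+] --> V + ((k * (2 * n))%:E + k%:E * lam setT).
Proof.
move=> V_fin lamI0; have lam_fin : lam setT \is a fin_num by exact: fin_num_measure.
apply: cvgeD; [exact: fin_num_adde_defr|exact: cvg_cst|].
apply: cvgeD; first exact: fin_num_adde_defr.
  apply: cvg_EFin; first exact: nearW.
  apply: cvg_at_right_filter; apply: cvgM; first exact: cvg_cst.
  apply: cvgM; last exact: cvg_cst.
  by rewrite -[X in _ --> X]addr0; apply: cvgD; [exact: cvg_cst|exact: cvg_id].
apply: cvgeZl => //; rewrite -[X in _ --> X]adde0.
apply: cvgeD; [exact: fin_num_adde_defl|exact: cvg_cst|].
exact: (cvg_comp _ _ cvg_layer_width (cvg_layer_mass lamI0)).
Qed.

End mollified_charges.

Section variation_off.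
Context {R : realType}.
Local Notation RT := (measurableTypeR R).
Implicit Types (nu : @sm R) (A B D : set R) (s : seq R).
Local Open Scope ereal_scope.

Let measurable_off s : measurable (~` [set` s] : set RT).
Proof.
by apply/measurableC/finite_set_measurable; [exact: measurable_set1|exact: finite_seq].
Qed.

Let variation_off_lty nu s : variation nu (~` [set` s]) < +oo.
Proof. by rewrite ltey_eq fin_num_measure. Qed.

Definition variation_off nu s : {finite_measure set RT -> \bar R} :=
  mfrestr (measurable_off s) (variation_off_lty nu s).

Lemma variation_offE nu s A : variation_off nu s A = variation nu (A `&` ~` [set` s]).
Proof. by []. Qed.

Lemma dominated_off_variation nu s : dominated_off s nu (variation_off nu s).
Proof.
move=> A mA As; rewrite variation_offE (setIidl _); first exact: abse_le_variation.
by move=> x Ax /= /As.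
Qed.

Lemma sub_le_tv (nu : set R -> \bar R) A B D : measurable A -> measurable B ->
  A `<=` D -> B `<=` D -> A `&` B = set0 -> nu A - nu B <= tv nu D.
Proof.
move=> mA mB AD BD AB0.
pose E i : set R := if i is 0%N then A else if i is 1%N then B else set0.
apply: (@le_trans _ _ (\sum_(i < 2) `|nu (E i)|)); last first.
  apply: ereal_sup_ubound; exists 2%N, E.
  split; first by move=> [|[|i]]; split=> //; exact: measurable0.
  by split=> // -[|[|i]] [|[|j]] //= _; rewrite ?set0I ?setI0// setIC.
rewrite !big_ord_recl big_ord0 adde0/=; apply: leeD; first exact: lee_abs.
by rewrite -abseN lee_abs.
Qed.

Lemma tv_ge0 (nu : set R -> \bar R) D : 0 <= tv nu D.
Proof.
apply: ereal_sup_ubound; exists 0%N, (fun=> set0); split; first by move=> i; split.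
by split; [move=> i j _; rewrite set0I|rewrite big_ord0].
Qed.

End variation_off.

Section admissible_pair.
Context {R : realType}.
Local Notation RT := (measurableTypeR R).
Local Notation leb := (@lebesgue_measure R).
Implicit Types (d e x : R) (A : set R) (s : seq R).
Local Open Scope ereal_scope.

Variables (a b K c0 : R) (u u' g : R -> R) (gamma Du Ds : @sm R).
Hypotheses (ab : (a < b)%R) (c0_gt0 : (0 < c0)%R).
Hypotheses (uBV : BVder a b u Du) (Du_dec : lebdec a b Du u' Ds) (u_le : Linf_bd a b u K).
Hypothesis gL1 : L1 a b g.
Hypothesis gammaE : forall A : set R, measurable A ->
  gamma A = Ds A + \int[leb]_(x in A `&` I a b) (g x)%:E.
Hypothesis u'B_g_L2 : L2 a b (fun x => u' x - g x)%R.

Let Du_I : concentrated a b Du := proj1 (proj2 uBV).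
Let mI : measurable (I a b : set RT) := measurable_I a b.
Local Notation J := (jumpset a b Du).

(* The singular part [Ds] is common to [Du] and [gamma], so it cancels. *)
Lemma mollify_sub_lavg d x :
  (mollify Du d x - mollify gamma d x = lavg d ((fun x => u' x - g x) \_ (I a b)) x)%R.
Proof.
have [u'L1 [_ [_ DuE]]] := Du_dec.
rewrite /mollify /lavg -mulrBl mulrC; congr (_ * _)%R.
set W : set RT := `](x - d)%R, x]%classic; have mW : measurable W by exact: measurable_itv.
have mWI : measurable (W `&` I a b) by exact: measurableI.
have iWI f : L1 a b f -> leb.-integrable (W `&` I a b) (EFin \o f).
  by apply: (integrableS mI) => //; exact: subIsetr.
rewrite /Rintegral integral_patch_EFin DuE// gammaE// integralB_EFin; [|by []|exact: iWI..].
have /= intu' := integrable_fin_num mWI (iWI _ u'L1).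
have /= intg := integrable_fin_num mWI (iWI _ gL1).
have Ds_fin : Ds W \is a fin_num by exact: fin_num_measure.
by rewrite (fineD intu' Ds_fin) (fineD Ds_fin intg) (fineB intu' intg); lra.
Qed.

Lemma integral_sqr_mollify_sub_le d : (0 < d)%R ->
  \int[leb]_(x in I a b) ((mollify Du d x - mollify gamma d x) ^+ 2)%:E <=
  \int[leb]_(x in I a b) ((u' x - g x) ^+ 2)%:E.
Proof.
move=> d0; have [u'L1 _] := Du_dec; set v := ((fun x => u' x - g x) \_ (I a b))%R.
have iv : leb.-integrable setT (EFin \o v).
  rewrite -restrict_EFin; apply/integrable_restrict => //; rewrite setTI.
  exact: integrableB_EFin.
apply: le_trans (le_trans (ge0_le_integralT leb (f2 := fun x => ((lavg d v x) ^+ 2)%:E) _ _ _)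
  (integral_sqr_lavg_le d0 iv)) _.
- by move=> x _; rewrite lee_fin sqr_ge0.
- by move=> x; rewrite lee_fin sqr_ge0.
- by move=> x _; rewrite mollify_sub_lavg.
rewrite [leRHS]integral_mkcond le_eqVlt; apply/predU1P; left.
by apply: eq_integral => x _; rewrite /v !patchE; case: ifPn => // _; rewrite expr0n.
Qed.

Section representative.
Variable c : R.
Hypothesis u_bvfun : {ae leb, forall x, I a b x -> (u x = bvfun c (jordanP Du) (jordanN Du) x)%R}.
Local Notation w := (bvfun c (jordanP Du) (jordanN Du)).

Lemma integral_dist_recovery_le d : (0 < d)%R ->
  \int[leb]_(x in I a b) (`|lavg d w x - u x|)%:E <= d%:E * variation Du setT.
Proof.
move=> d0; rewrite variationE; apply: le_trans (lavg_bvfun_dist_le a b c _ _ d0).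
rewrite le_eqVlt; apply/predU1P; left.
have [u_L1 _] := uBV; have [avg_L1 _] := W11_lavg_bvfun a b c (jordanP Du) (jordanN Du) d0.
have mdist v : L1 a b v -> measurable_fun (I a b : set RT) (fun x => (`|lavg d w x - v x|)%:E).
  move=> v_L1; apply/measurable_EFinP/measurableT_comp => //; apply: measurable_funB.
    by have /measurable_int/measurable_EFinP := avg_L1.
  by have /measurable_int/measurable_EFinP := v_L1.
apply: ae_eq_integral => //; first exact: mdist.
- by apply: mdist; exact: bvfun_L1.
- by apply: aeS u_bvfun => x u_w Ix; rewrite u_w.
Qed.

Lemma normr_recovery_le d x : (0 < d)%R -> (x < b)%R -> (`|lavg d w x| <= K)%R.
Proof.
move=> d0 xb; have left0 (m : {finite_measure set RT -> \bar R}) :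
    (forall A, measurable A -> m A <= variation Du A) -> m `]-oo, a]%classic = 0.
  move=> m_le; apply/eqP; rewrite eq_le measure_ge0 andbT.
  apply: le_trans (m_le _ _) _; first exact: measurable_itv.
  rewrite -(variation_concentrated Du_I); apply: le_measure; rewrite ?inE.
  - exact: measurable_itv.
  - exact: measurableC.
  - by move=> t; rewrite /I/= !in_itv/=; lra.
apply: (lavg_bvfun_le d0 _ xb); apply: (bvfun_le_left ab).
- by apply: left0 => A mA; rewrite variationE leeDl.
- by apply: left0 => A mA; rewrite variationE leeDr.
- move: u_bvfun u_le; apply: filterS2; first exact: (ae_filter_ringOfSetsType leb).
  by move=> y u_w y_le_K Iy; rewrite -u_w//; exact: y_le_K.
Qed.

Lemma Eeps_recovery_le d e : (0 < d)%R ->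
  Eeps a b K c0 e (lavg d w) (mollified_charge a b gamma d) <=
  \int[leb]_(x in I a b) ((u' x - g x) ^+ 2)%:E +
  e^-1%:E * \int[leb]_(x in I a b) (fc c0 (e * avg a b e (mollify gamma d) x))%:E.
Proof.
move=> d0; apply: le_trans (leeD2r _ (integral_sqr_mollify_sub_le d0)).
apply: ereal_inf_lbound; exists (mollify Du d), (mollify gamma d).
split; first by rewrite mollify_jordan; exact: W11_lavg_bvfun.
split; first by apply: aeW => x; rewrite /I/= in_itv/= => /andP[_ xb]; exact: normr_recovery_le.
split; first exact: integrable_mollify_charge.
split; first by move=> A _; exact: mollified_chargeE.
split=> //; split; last exact: le_lt_trans (integral_sqr_mollify_sub_le d0) u'B_g_L2.2.
by apply: measurable_funB; exact: measurable_mollify_charge.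
Qed.

Lemma Eeps_recovery_sqr_le (B : seq R) (lam : {finite_measure set RT -> \bar R}) e :
  dominated_off B gamma lam -> (0 < e)%R -> (2 * e < b - a)%R ->
  Eeps a b K c0 e (lavg (e ^+ 2) w) (mollified_charge a b gamma (e ^+ 2)) <=
  \int[leb]_(x in I a b) ((u' x - g x) ^+ 2)%:E +
  ((c0 * ((2 + e) * (size B)%:R))%:E +
   c0%:E * (lam setT + lam (layer a b (2 * e + e ^+ 2)))).
Proof.
move=> gamma_lam e0 eab; have e20 : (0 < e ^+ 2)%R by rewrite exprn_gt0.
apply: le_trans (Eeps_recovery_le _ e20) _; apply: leeD2l; rewrite lee_pdivrMl//.
apply: le_trans (nonlocal_energy_le c0_gt0 e20 e0 eab gamma_lam) _.
rewrite [leRHS]ge0_muleDr.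
- rewrite muleA -!EFinM (mulrC e c0) le_eqVlt; apply/predU1P; left; congr (_%:E + _).
  by rewrite expr2; lra.
- by rewrite lee_fin !mulr_ge0 ?addr_ge0// ltW.
- by rewrite mule_ge0 ?adde_ge0// lee_fin ltW.
Qed.

End representative.

Lemma Eupper_le_dominated (B : seq R) (lam : {finite_measure set RT -> \bar R}) :
  dominated_off B gamma lam -> lam (~` I a b) = 0 ->
  Eupper a b K c0 u gamma <=
  \int[leb]_(x in I a b) ((u' x - g x) ^+ 2)%:E +
  ((c0 * (2 * (size B)%:R))%:E + c0%:E * lam setT).
Proof.
move=> gamma_lam lamI0; have [c u_bvfun] := BV_representation ab uBV.
have eab : \forall e \near 0%R^'+, (2 * e < b - a)%R.
  near=> e; rewrite mulrC -ltr_pdivlMr//; near: e.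
  by apply: nbhs_right_lt; rewrite divr_gt0// subr_gt0.
pose w := bvfun c (jordanP Du) (jordanN Du).
apply: le_trans (ereal_inf_lbound _) _.
  exists (fun e => lavg (e ^+ 2) w), (fun e => mollified_charge a b gamma (e ^+ 2)).
  split; [|split; [|reflexivity]].
  - apply: (@cvg0_sqr_le _ _ (fine (variation Du setT))).
    near=> e; have e0 : (0 < e)%R by near: e; exact: nbhs_right_gt.
    rewrite integral_ge0//= fineK ?fin_num_measure//.
    by apply: integral_dist_recovery_le; rewrite ?exprn_gt0.
  - apply: (@cvg0_sqr_le _ _ (fine (variation gamma setT))).
    near=> e; have e0 : (0 < e)%R by near: e; exact: nbhs_right_gt.
    rewrite flatdist_ge0/= fineK ?fin_num_measure//.
    by apply: flatdist_mollified_charge_le; rewrite ?exprn_gt0.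
set V := \int[leb]_(x in I a b) _.
have V_fin : V \is a fin_num.
  by rewrite ge0_fin_numE ?u'B_g_L2.2// integral_ge0// => x _; rewrite lee_fin sqr_ge0.
have lam_fin : lam setT \is a fin_num by exact: fin_num_measure.
have l_fin : V + ((c0 * (2 * (size B)%:R))%:E + c0%:E * lam setT) \is a fin_num.
  by rewrite fin_numD V_fin/= fin_numD fin_numM.
rewrite -(fineK l_fin); apply: limf_esup_le_cvg.
  near=> e; apply: (Eeps_recovery_sqr_le u_bvfun gamma_lam); near: e => //.
  exact: nbhs_right_gt.
by rewrite fineK//; exact: cvg_energy_bound.
Unshelve. all: by end_near. Qed.

Lemma concentrated_gamma : concentrated a b gamma.
Proof.
have [_ [Ds_I _]] := Du_dec.
by move=> A mA; rewrite !gammaE//; [rewrite -Ds_I// -setIA setIid|exact: measurableI].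
Qed.

Lemma gamma_set1 x : gamma [set x] = Du [set x].
Proof.
have [_ [_ [_ DuE]]] := Du_dec.
have int0 (f : R -> R) : \int[leb]_(t in [set x] `&` I a b) (f t)%:E = 0.
  by apply: (@integral_Sset1 _ _ _ x); exact: subIsetl.
rewrite gammaE ?DuE; [|exact: measurable_set1..].
by rewrite !int0 add0e adde0.
Qed.

Lemma jumpset_atoms : J = [set x | variation gamma [set x] != 0].
Proof.
apply/seteqP; split => x /=; rewrite variation_set1 gamma_set1 abse_eq0; first by case.
move=> Dux; split=> //; apply: contrapT => xI; move/negP: Dux; apply; apply/eqP.
rewrite Du_I; last exact: measurable_set1.
by rewrite (_ : _ `&` _ = set0) ?charge0//; apply/seteqP; split => y //= [->].
Qed.

Lemma countable_jumpset : countable J.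
Proof.
by rewrite jumpset_atoms; apply: (countable_atoms (variation gamma)) => x.
Qed.

Lemma measurable_jumpset : measurable (J : set RT).
Proof.
by apply: countable_measurable countable_jumpset => x; exact: measurable_set1.
Qed.

Lemma variation_diffuse_le : variation gamma (~` J) <=
  \int[leb]_(x in I a b) (`|g x|)%:E + tv (cantor_part a b Du Ds) (I a b).
Proof.
have [_ [Ds_I _]] := Du_dec; have mJ := measurable_jumpset.
have mP := measurable_hahnP gamma; have mN := measurable_hahnN gamma.
have [_ _ _ PN0] := hahnH gamma.
pose P : set RT := I a b `&` hahnP gamma; pose N : set RT := I a b `&` hahnN gamma.
have mPI : measurable P by exact: measurableI.
have mNI : measurable N by exact: measurableI.
have PN : P `&` N = set0 by rewrite setIACA setIid PN0 setI0.
have offJ (H : set RT) : measurable H -> gamma (~` J `&` H) =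
    \int[leb]_(x in (I a b `&` H) `\` J) (g x)%:E + cantor_part a b Du Ds (I a b `&` H).
  move=> mH; rewrite gammaE; last by apply: measurableI => //; exact: measurableC.
  rewrite /cantor_part Ds_I; last by apply: measurableI => //; exact: measurableC.
  by rewrite addeC (_ : ~` J `&` H `&` I a b = (I a b `&` H) `\` J)// setDE setIC setIA setIAC.
rewrite variation_hahn; last exact: measurableC.
rewrite !offJ// -/P -/N; have [PI NI] : P `<=` I a b /\ N `<=` I a b by split; exact: subIsetl.
have cN_fin : cantor_part a b Du Ds N \is a fin_num by apply: fin_num_measure; exact: measurableD.
rewrite fin_num_oppeD// addeACA; apply: leeD; last exact: sub_le_tv.
have setDI (E : set R) : E `\` J `<=` E by exact: subDsetl.
apply: integral_sub_le => //; [exact: measurableD|exact: measurableD| | |].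
- exact: subset_trans (setDI P) PI.
- exact: subset_trans (setDI N) NI.
- by apply/seteqP; split=> // x [[Px _] [Nx _]]; rewrite -PN.
Qed.

Definition big_jumps : set R := J `&` [set x | (2 <= `|fine (Du [set x])|)%R].

Let variation_jump x : variation gamma [set x] = (`|fine (Du [set x])|)%:E.
Proof.
have Dux_fin : Du [set x] \is a fin_num by apply: fin_num_measure; exact: measurable_set1.
by rewrite variation_set1 gamma_set1 -{1}(fineK Dux_fin).
Qed.

Lemma finite_big_jumps : finite_set big_jumps.
Proof.
have heavy := @finite_heavy_atoms _ _ _ (variation gamma) 2 (@measurable_set1 R) (ltr0n R 2).
by apply: sub_finite_set heavy => x [_ /=]; rewrite variation_jump.
Qed.

(* Below the threshold [fc] is linear with slope [c0], so the small jumps contribute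
   [c0] times their mass; a big jump contributes [2 * c0] whatever its size. *)
Lemma jump_energyE s : uniq s -> [set` s] = big_jumps ->
  2%:E * (\esum_(x in J) (fc c0 (`|fine (Du [set x])| / 2))%:E) =
  (c0 * (2 * (size s)%:R))%:E + c0%:E * variation gamma (J `\` [set` s]).
Proof.
move=> s_uniq s_big; have fc_ge0 (t : R) : (0 <= t)%R -> (0 <= fc c0 t)%R.
  by move=> t0; rewrite mulr_ge0 ?(ltW c0_gt0)// le_min t0 ler01.
have big_fc : \esum_(x in J `&` [set` s]) (fc c0 (`|fine (Du [set x])| / 2))%:E =
    (c0 * (size s)%:R)%:E.
  rewrite {1}s_big /big_jumps setIA setIid -/big_jumps -s_big.
  rewrite (eq_esum (b := fun=> c0%:E)) => [|x]; last first.
    rewrite s_big => -[_ /= big_x]; rewrite /fc; congr EFin.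
    by rewrite (min_idPr _) ?mulr1//; lra.
  rewrite esum_fset; [|exact: finite_seq|by move=> x _; rewrite lee_fin ltW].
  by rewrite -fsbig_seq// sumEFin big_const_seq count_predT iter_addr_0 mulr_natr.
have small_fc : \esum_(x in J `&` ~` [set` s]) (fc c0 (`|fine (Du [set x])| / 2))%:E =
    (c0 / 2)%:E * variation gamma (J `\` [set` s]).
  rewrite measure_countable_esum; [|exact: measurable_set1|].
  - rewrite -ge0_esumZl ?divr_ge0 ?(ltW c0_gt0)//; apply: eq_esum => x [Jx /= xs].
    rewrite variation_jump -EFinM /fc -mulrA (mulrC 2^-1%R); congr (c0 * _)%:E.
    apply/min_idPl; rewrite leNgt; apply/negP => big_x; apply: xs.
    have : big_jumps x by split=> //=; lra.
    by rewrite -s_big.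
  - exact: sub_countable (subset_card_le (@subDsetl _ _ _)) countable_jumpset.
rewrite (esumID [set` s]) => [|x _]; last by rewrite lee_fin fc_ge0.
rewrite big_fc small_fc ge0_muleDr.
- by rewrite muleA -!EFinM; congr (_%:E + _%:E * _); lra.
- by rewrite lee_fin mulr_ge0// ltW.
- by rewrite mule_ge0// lee_fin divr_ge0// ltW.
Qed.

Lemma variation_off_le s : [set` s] = big_jumps ->
  variation_off gamma s setT <=
  \int[leb]_(x in I a b) (`|g x|)%:E + tv (cantor_part a b Du Ds) (I a b) +
  variation gamma (J `\` [set` s]).
Proof.
move=> s_big; have mJ := measurable_jumpset.
have ms := finite_set_measurable (@measurable_set1 R) (finite_seq s).
rewrite variation_offE setTI.
apply: (@le_trans _ _ (variation gamma (~` J `|` (J `\` [set` s])))).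
  apply: le_measure; rewrite ?inE.
  - exact: measurableC.
  - by apply: measurableU; [exact: measurableC|exact: measurableD].
  - by move=> x xs; have [Jx|] := pselect (J x); [right|left].
apply: le_trans (measureU2 _ _ _) _; [exact: measurableC|exact: measurableD|].
by apply: leeD2r; exact: variation_diffuse_le.
Qed.

Lemma Eupper_le_energy :
  Eupper a b K c0 u gamma <=
  \int[leb]_(x in I a b) ((u' x - g x) ^+ 2)%:E
  + c0%:E * \int[leb]_(x in I a b) (`|g x|)%:E
  + 2%:E * (\esum_(x in J) (fc c0 (`|fine (Du [set x])| / 2))%:E)
  + c0%:E * tv (cantor_part a b Du Ds) (I a b).
Proof.
have /finite_seqP[t t_big] := finite_big_jumps; pose s := undup t.
have s_big : [set` s] = big_jumps.
  by rewrite t_big; apply/seteqP; split => x /=; rewrite mem_undup.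
apply: le_trans (Eupper_le_dominated (@dominated_off_variation _ gamma s) _) _.
  have mC := measurableC mI; have ms := finite_set_measurable (@measurable_set1 R) (finite_seq s).
  rewrite variation_offE; apply: subset_measure0 (variation_concentrated concentrated_gamma) => //.
  by apply: measurableI => //; exact: measurableC.
have := variation_off_le s_big; rewrite (jump_energyE (undup_uniq t) s_big).
have : 0 <= \int[leb]_(x in I a b) (`|g x|)%:E by exact: integral_ge0.
have := tv_ge0 (cantor_part a b Du Ds) (I a b).
have : 0 <= variation gamma (J `\` [set` s]) by exact: measure_ge0.
move: (\int[_]_(x in _) (`|_|)%:E) (tv _ _) (variation _ _) (\int[_]_(x in _) (_ ^+ 2)%:E).
move=> G T S V S0 T0 G0 off_le.
rewrite -!addeA; apply: leeD2l; rewrite [leRHS]addeCA; apply: leeD2l.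
rewrite -!ge0_muleDr ?adde_ge0//.
by rewrite lee_wpmul2l ?lee_fin ?(ltW c0_gt0)// (addeC S) addeA.
Qed.

End admissible_pair.

Theorem mainTheorem14 (R : realType) (a b K c0 : R)
  (u : R -> R) (gamma : sm) (Du : sm) (u' : R -> R) (Ds : sm) (g : R -> R) :
  0 < a -> a < b -> 0 < c0 -> 0 < K ->
  BVder a b u Du -> lebdec a b Du u' Ds ->
  Linf_bd a b u K ->
  L1 a b g ->
  (forall A : set R, measurable A ->
     gamma A = (Ds A + \int[lebesgue_measure]_(x in A `&` I a b) (g x)%:E)%E) ->
  L2 a b (fun x => u' x - g x) ->
  (Eupper a b K c0 u gamma <= Elim a b K c0 u gamma)%E.
Proof.
move=> _ ab c0_gt0 _ _ _ _ _ _ _; apply/ereal_infP => v [Dv [v' [Ds' [h]]]].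
move=> [vBV [Dv_dec [v_le [hL1 [gammaE [L2_v'h ->]]]]]].
exact: Eupper_le_energy ab c0_gt0 vBV Dv_dec v_le hL1 gammaE L2_v'h.
Qed.
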